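(* Let $\omega\in A_1$ on $\mathbb R^n$. For $1\leq p<\infty$ and $f\in L^1_{\mathrm{loc}}(\mathbb R^n)$ define $$\|f\|_{\mathrm{BLO}^p(\omega)}:=\sup_{\mathcal{Q}\subset\mathbb R^n}\bigg(\frac{1}{\omega(\mathcal{Q})}\int_{\mathcal{Q}}\Big[f(x)-\underset{y\in\mathcal{Q}}{\mathrm{ess\,inf}}\,f(y)\Big]^p\omega(x)^{1-p}dx\bigg)^{1/p},$$ the supremum being over all cubes, and write $\|\cdot\|_{\mathrm{BLO}(\omega)}$ for $\|\cdot\|_{\mathrm{BLO}^1(\omega)}$. Then for each $1<p<\infty$ the quantities $\|f\|_{\mathrm{BLO}^p(\omega)}$ and $\|f\|_{\mathrm{BLO}(\omega)}$ are equivalent (each is bounded by a constant, independent of $f$, times the other). More precisely, $$\|f\|_{\mathrm{BLO}(\omega)}\leq\|f\|_{\mathrm{BLO}^p(\omega)}\leq[\omega]_{A_1}\big(C^{*}\, p\,\Gamma(p)\big)^{1/p}\cdot\frac{C_1^{\delta/p}}{C_2\,\delta}\,\|f\|_{\mathrm{BLO}(\omega)},$$ where $C_1=e$, $C_2=\frac1{2^ne}$, $\Gamma(p)=\int_0^\infty\mu^{p-1}e^{-\mu}\,d\mu$, and $C^*,\delta>0$ are the constants given in the context.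
   Context: $m$ denotes Lebesgue measure; cubes have sides parallel to the coordinate axes. A weight $\omega$ is a nonnegative locally integrable function on $\mathbb R^n$ with values in $(0,\infty)$ a.e.; $\omega(E):=\int_E\omega\,dx$. $\omega\in A_1$ means there is $C>0$ with $\frac{\omega(\mathcal Q)}{m(\mathcal Q)}\leq C\,\mathrm{ess\,inf}_{x\in \mathcal Q}\,\omega(x)$ for every cube $\mathcal Q\subset\mathbb R^n$; the smallest such $C$ is $[\omega]_{A_1}$. For $1<p<\infty$, $p'=p/(p-1)$, a weight $\nu$ is in $A_p$ if $[\nu]_{A_p}:=\sup_{\mathcal Q}\big(\frac1{m(\mathcal Q)}\int_{\mathcal Q}\nu\,dx\big)\big(\frac1{m(\mathcal Q)}\int_{\mathcal Q}\nu^{1-p'}dx\big)^{p-1}<\infty$. Constants $C^*,\delta$: for $1<p<\infty$ and $\omega\in A_1$ the weight $\nu:=\omega^{1-p}$ belongs to $A_p$, and $C^*,\delta>0$ are constants such that $\frac{\nu(E)}{\nu(\mathcal Q)}\leq C^*\big(\frac{m(E)}{m(\mathcal Q)}\big)^{\delta}$ for every cube $\mathcal Q$ and every measurable $E\subseteq\mathcal Q$; the paper's choice is $C^*=2$ and $\delta=\frac{\varepsilon}{1+\varepsilon}$ with $\varepsilon=\frac{1}{2^{2p+1+n}[\nu]_{A_p}}$. *)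

(* Defs.v *)
From HB Require Import structures.
From mathcomp Require Import all_boot all_order all_algebra.
From mathcomp Require Import all_classical all_reals all_analysis.
From mathcomp Require Import ess_sup_inf.

Set Implicit Arguments.
Unset Strict Implicit.
Unset Printing Implicit Defensive.

Import Order.TTheory GRing.Theory Num.Def Num.Theory.
Import numFieldNormedType.Exports.

Local Open Scope classical_set_scope.
Local Open Scope ring_scope.

Section tuple_cons.
Context {d : measure_display} {T : measurableType d} (n : nat).

Definition tcons (x : T * n.-tuple T) : n.+1.-tuple T :=
  [the n.+1.-tuple T of x.1 :: x.2].

Lemma measurable_tcons : measurable_fun [set: T * n.-tuple T] tcons.
Proof. exact: (measurable_cons measurable_fst measurable_snd). Qed.

Definition tuncons (t : n.+1.-tuple T) : T * n.-tuple T :=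
  (thead t, [tuple of behead t]).

Lemma tconsK : cancel tcons tuncons.
Proof.
by case=> x t; rewrite /tuncons /tcons/= theadE; congr pair; exact: val_inj.
Qed.

Lemma tunconsK : cancel tuncons tcons.
Proof.
by move=> t; rewrite /tcons/=; apply: val_inj; rewrite [in RHS](tuple_eta t).
Qed.

Lemma measurable_tuncons : measurable_fun [set: n.+1.-tuple T] tuncons.
Proof.
apply/measurable_fun_pairP; split.
  exact: (measurable_tnth ord0).
exact: measurable_behead.
Qed.

End tuple_cons.

Section tuple_product_measure.
Context {d : measure_display} {T : measurableType d} {R : realType} (n : nat).
Variables (m : {sigma_finite_measure set T -> \bar R})
  (mu : {sigma_finite_measure set (n.-tuple T) -> \bar R}).
Local Open Scope ereal_scope.

Definition tuple_product_measure : set (n.+1.-tuple T) -> \bar R :=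
  pushforward (m \x mu) (@tcons _ T n).

Let measurable_tcons_preimage (A : set (n.+1.-tuple T)) :
  measurable A -> measurable (@tcons _ T n @^-1` A).
Proof.
by move=> mA; rewrite -[X in measurable X]setTI; exact: measurable_tcons.
Qed.

Let tuple_product0 : tuple_product_measure set0 = 0.
Proof.
by rewrite /tuple_product_measure /pushforward preimage_set0 measure0.
Qed.

Let tuple_product_ge0 A : 0 <= tuple_product_measure A.
Proof. by rewrite /tuple_product_measure /pushforward measure_ge0. Qed.

Let tuple_product_sigma_additive : semi_sigma_additive tuple_product_measure.
Proof.
move=> F mF tF mUF; rewrite /tuple_product_measure /pushforward preimage_bigcup.
apply: measure_semi_sigma_additive.
- by move=> k; exact: measurable_tcons_preimage.
- apply/trivIsetP => /= i j _ _ ij; rewrite -preimage_setI.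
  by move/trivIsetP : tF => /(_ _ _ _ _ ij) ->//; rewrite preimage_set0.
- by rewrite -preimage_bigcup; exact: measurable_tcons_preimage.
Qed.

HB.instance Definition _ := isMeasure.Build _ _ _ tuple_product_measure
  tuple_product0 tuple_product_ge0 tuple_product_sigma_additive.

Let tuple_product_sigma_finite : sigma_finite setT tuple_product_measure.
Proof.
have /sigma_finiteP[F [TF ndF Foo]] := sigma_finiteT m.
have /sigma_finiteP[G [TG ndG Goo]] := sigma_finiteT mu.
exists (fun k => @tuncons _ T n @^-1` (F k `*` G k)).
  rewrite -preimage_bigcup predeqE => t; split=> // _.
  have [i _ Fi] : (\bigcup_k F k) (tuncons t).1 by rewrite -TF.
  have [j _ Gj] : (\bigcup_k G k) (tuncons t).2 by rewrite -TG.
  exists (maxn i j) => //; split.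
    by move: Fi; exact/subsetPset/ndF/leq_maxl.
  by move: Gj; exact/subsetPset/ndG/leq_maxr.
move=> k; have [mF Fk] := Foo k; have [mG Gk] := Goo k; split.
  rewrite -[X in measurable X]setTI; apply: measurable_tuncons => //.
  exact: measurableX.
rewrite /tuple_product_measure /pushforward -comp_preimage.
rewrite (_ : _ \o _ = id) ?preimage_id; last first.
  by apply/funext => x; exact: tconsK.
by rewrite product_measure1E// lte_mul_pinfty// ge0_fin_numE.
Qed.

HB.instance Definition _ := Measure_isSigmaFinite.Build _ _ _
  tuple_product_measure tuple_product_sigma_finite.

End tuple_product_measure.

Fixpoint borel_lebesgue (R : realType) (n : nat) :
    {sigma_finite_measure set (n.-tuple (measurableTypeR R)) -> \bar R} :=
  match n with
  | 0 => \d_ [tuple]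
  | k.+1 => tuple_product_measure (@lebesgue_measure R) (borel_lebesgue R k)
  end.

Section euclidean_space.
Context (R : realType) (n : nat).

(* [Rn] carries the sigma-algebra of all Lebesgue measurable sets (the
   Caratheodory-measurable ones), and [leb] is the complete Lebesgue measure *)
Definition Rn : measurableType _ :=
  caratheodory_type ((borel_lebesgue R n)^*)%mu.

Definition leb : set Rn -> \bar R :=
  @completed_measure_extension _ _ _ (borel_lebesgue R n).

HB.instance Definition _ := Measure.on leb.

Let leb_sigma_finite : sigma_finite setT leb.
Proof. exact: completed_measure_extension_sigma_finite. Qed.

HB.instance Definition _ := Measure_isSigmaFinite.Build _ _ _ leb
  leb_sigma_finite.

Definition pcoord (x : Rn) (i : 'I_n) : R := tnth (x : n.-tuple R) i.

Definition cube (a : Rn) (r : R) : set Rn :=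
  [set x | forall i, pcoord a i <= pcoord x i <= pcoord a i + r].

Lemma measurable_cube a r : measurable (cube a r).
Proof.
apply: sub_caratheodory; apply: sub_sigma_algebra.
rewrite (_ : cube a r = \bigcap_(i in [set: 'I_n])
  ((fun x : n.-tuple (measurableTypeR R) => tnth x i) @^-1`
     `[pcoord a i, pcoord a i + r])); last first.
  apply/seteqP; split => [x xa i _ | x xa i] /=.
    by rewrite in_itv/=; exact: xa.
  by have := xa i I; rewrite /= in_itv.
apply: fin_bigcap_measurable => // i _.
have mI : measurable
  (`[pcoord a i, pcoord a i + r]%classic : set (measurableTypeR R)).
  exact: measurable_itv.
have := @measurable_tnth _ (measurableTypeR R) n i measurableT _ mI.
by rewrite setTI.
Qed.

End euclidean_space.
Arguments Rn : clear implicits.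
Arguments leb : clear implicits.

Section weights.
Context {R : realType} {n : nat}.
Local Notation Rn := (Rn R n).
Local Notation leb := (leb R n).
Implicit Types (f w nu : Rn -> R) (a : Rn) (p r : R).
Local Open Scope ereal_scope.

(* every compact set lies in a cube *)
Definition loc_integrable f :=
  forall a r, leb.-integrable (cube a r) (EFin \o f).

Definition weight w :=
  [/\ (forall x, (0 <= w x)%R), (\forall x \ae leb, (0 < w x)%R) &
      loc_integrable w].

Definition wmeas w (E : set Rn) : \bar R := \int[leb]_(x in E) (w x)%:E.

Definition ess_inf_cube a r f : \bar R :=
  ess_inf (mrestr leb (measurable_cube a r)) (EFin \o f).

(* [C] is admissible in the A_1 condition; [A1_const] is the least such [C] *)
Definition A1_bound w (C : R) := (0 < C)%R /\
  forall a r, (0 < r)%R ->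
    wmeas w (cube a r) / leb (cube a r) <= C%:E * ess_inf_cube a r w.

Definition A1 w := weight w /\ exists C, A1_bound w C.

Definition A1_const w : R := inf [set C | A1_bound w C].

Definition conj_exp p : R := (p / (p - 1))%R.

(* 0 `^ s = 0 for s != 0: harmless, as weights are positive a.e. *)
Definition wpow w (s : R) : Rn -> R := fun x => (w x `^ s)%R.

Definition Ap_const p nu : \bar R :=
  ereal_sup [set (wmeas nu (cube c.1 c.2) / leb (cube c.1 c.2)) *
    (wmeas (wpow nu (1 - conj_exp p)) (cube c.1 c.2) / leb (cube c.1 c.2))
      `^ (p - 1) | c in [set c : Rn * R | (0 < c.2)%R]].

Definition Ainfty_bound nu (C delta : R) :=
  forall a r (E : set Rn), (0 < r)%R -> measurable E -> E `<=` cube a r ->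
    wmeas nu E / wmeas nu (cube a r) <=
      C%:E * (leb E / leb (cube a r)) `^ delta.

(* extended-real valued: when [f] is not essentially bounded below on some cube,
   the integrand is +oo a.e. there and the norm is +oo *)
Definition BLO_norm w p f : \bar R :=
  ereal_sup [set
    ((wmeas w (cube c.1 c.2))^-1 *
     \int[leb]_(x in cube c.1 c.2)
       (((f x)%:E - ess_inf_cube c.1 c.2 f) `^ p * (w x `^ (1 - p))%R%:E))
      `^ p^-1 | c in [set c : Rn * R | (0 < c.2)%R]].

End weights.

Definition Gamma {R : realType} (p : R) : R :=
  \int[lebesgue_measure]_(u in `]0, +oo[) (u `^ (p - 1) * expR (- u)).

(* the reverse Hoelder exponent of an A_p weight [nu], giving the A_infty
   constants C = 2 and delta = eps / (1 + eps) *)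
Definition Ap_eps {R : realType} {n : nat} (p : R) (nu : Rn R n -> R) : R :=
  (2 `^ (2 * p + 1 + n%:R) * fine (Ap_const p nu))^-1.

Definition BLO_const {R : realType} {n : nat} (w : Rn R n -> R)
    (p C delta : R) : R :=
  let C1 := expR 1 in
  let C2 := (2 ^+ n * expR 1)^-1 in
  A1_const w * (C * p * Gamma p) `^ p^-1 * (C1 `^ (delta / p) / (C2 * delta)).

(* Main.v *)
(** The A_1 condition alone gives the bound with C^* = delta = 1, so no reverse
    Hoelder inequality is needed: an admissible pair must satisfy C >= 1 (take
    E = Q) and delta <= 1 (sum over the dyadic subcubes of Q), and the paper's
    choice satisfies both, while [BLO_const] only grows when C increases above
    1 or delta decreases below 1.

    Write a_Q, alpha_Q for the essential infima over Q of w, f, and let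
    B = 2^n e [w] M, where M bounds ||f||_BLO(w).  The mean over Q of f - alpha_Q
    is at most M [w] a_Q; stopping at e times that height yields disjoint dyadic
    cubes Q_j of total measure at most |Q|/e with alpha_{Q_j} <= alpha_Q + B a_Q,
    and f <= alpha_Q + B a_Q / 2 a.e. outside them.  Iterating, and using
    w >= a_{Q_j} >= a_Q on the later generations, one gets by induction

      int_Q (f/B)^p w^(1-p) <= a_Q |Q| psi_N (alpha_Q/(B a_Q)) + c w(Q) + error,

    where psi_N(y) = sum_{k<N} e^-k ((y+k+1/2)^p - (k+1/2)^p) and
    c = e p Gamma(p).  The step closes because t psi_N(y/t) decreases in t and
    because w(Q \ U_j Q_j) >= (1 - 1/e) a_Q |Q|; this last inequality also makes
    the error, a truncation of the integrand at a multiple of w, decay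
    geometrically in N.  Replacing f by f - alpha_Q kills the first term. *)
Require Import Defs.
From mathcomp Require Import all_boot all_order all_algebra.
From mathcomp Require Import all_classical all_reals all_analysis.
From mathcomp Require Import measurable_realfun ess_sup_inf.
From mathcomp Require Import ring lra.

Set Implicit Arguments.
Unset Strict Implicit.
Unset Printing Implicit Defensive.
Import Order.TTheory GRing.Theory Num.Def Num.Theory.
Import numFieldNormedType.Exports.
Local Open Scope classical_set_scope.
Local Open Scope ring_scope.

(** * Boxes *)

Section box.
Context {R : realType}.

Definition box n (A : 'I_n -> set R) : set (n.-tuple (measurableTypeR R)) :=
  [set x | forall i, A i (tnth x i)].

Lemma measurable_box n (A : 'I_n -> set R) :
  (forall i, measurable (A i : set (measurableTypeR R))) -> measurable (box A).
Proof.
move=> mA; rewrite (_ : box A = \bigcap_(i in [set: 'I_n])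
  ((fun x : n.-tuple (measurableTypeR R) => tnth x i) @^-1` A i)); last first.
  by apply/seteqP; split => [x xA i _ | x xA i] /=; [exact: xA|exact: (xA i I)].
apply: fin_bigcap_measurable => // i _.
by have := @measurable_tnth _ (measurableTypeR R) n i measurableT _ (mA i); rewrite setTI.
Qed.

Lemma borel_lebesgue_box n (A : 'I_n -> set R) :
  (forall i, measurable (A i : set (measurableTypeR R))) ->
  borel_lebesgue R n (box A) = (\prod_(i < n) lebesgue_measure (A i))%E.
Proof.
elim: n A => [|n IH] A mA.
  rewrite big_ord0 /= diracE mem_set//.
  by move=> /= [].
rewrite big_ord_recl -IH//.
rewrite -product_measure1E//=; last exact: measurable_box.
rewrite /tuple_product_measure /pushforward; congr ((_ \x _)%E _).
apply/seteqP; split => [[x t] /= xt|[x t] /= [Ax At] i].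
  split; first exact: (xt ord0).
  by move=> i; have := xt (lift ord0 i); rewrite tnthS.
case: (unliftP ord0 i) => [j ->|->].
  by have := At j; rewrite tnthS.
by [].
Qed.

Lemma measurable_Rn n (A : set (n.-tuple (measurableTypeR R))) :
  measurable A -> measurable (A : set (Rn R n)).
Proof. by move=> mA; apply: sub_caratheodory; apply: sub_sigma_algebra. Qed.

Lemma lebE n (A : set (n.-tuple (measurableTypeR R))) :
  measurable A -> leb R n A = borel_lebesgue R n A.
Proof. by move=> mA; exact: measurable_mu_extE. Qed.

End box.

(** * Approximation in a generated sigma-algebra *)

Section approx.
Context {d} {T : measurableType d} {R : realType}.
Variables (mu : {finite_measure set T -> \bar R}) (G : set (set T)).
Hypotheses (G0 : G set0) (GC : forall A, G A -> G (~` A))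
  (GU : forall A B, G A -> G B -> G (A `|` B)) (mG : G `<=` measurable).

Definition symdiff (A B : set T) := (A `\` B) `|` (B `\` A).

(** The sets that the algebra [G] approximates in measure. Once they are known to form a
    sigma-algebra, everything that [G] generates can be approximated. *)
Definition approximable (A : set T) := measurable A /\
  forall e : R, 0 < e -> exists2 E, G E & (mu (symdiff A E) < e%:E)%E.

Lemma measurable_symdiff A B : measurable A -> measurable B ->
  measurable (symdiff A B).
Proof. by move=> mA mB; apply: measurableU; exact: measurableD. Qed.

Lemma approximableG A : G A -> approximable A.
Proof.
move=> GA; split; first exact: mG.
by move=> e e0; exists A => //; rewrite /symdiff !setDv setU0 measure0 lte_fin.
Qed.

Lemma approximableC A : approximable A -> approximable (~` A).
Proof.
move=> [mA hA]; split; first exact: measurableC.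
move=> e /hA[E GE AE]; exists (~` E); first exact: GC.
rewrite (_ : symdiff _ _ = symdiff A E)//.
by apply/seteqP; split => x; rewrite /symdiff /=;
  case: (pselect (A x)); case: (pselect (E x)); tauto.
Qed.

Lemma approximable_step A B (e : R) : measurable A -> measurable B ->
  (mu (symdiff A B) < (e / 2)%:E)%E ->
  (exists2 E, G E & (mu (symdiff B E) < (e / 2)%:E)%E) ->
  exists2 E, G E & (mu (symdiff A E) < e%:E)%E.
Proof.
move=> mA mB AB [E GE BE]; exists E => //; have mE := mG GE.
rewrite [e]splitr EFinD; apply: le_lt_trans (lteD AB BE).
apply: (@le_trans _ _ (mu (symdiff A B `|` symdiff B E))); last first.
  by apply: measureU2; exact: measurable_symdiff.
apply: le_measure; rewrite ?inE; try exact: measurable_symdiff.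
  by apply: measurableU; exact: measurable_symdiff.
by move=> x; rewrite /symdiff /=; case: (pselect (B x)); tauto.
Qed.

Lemma approximableU A B : approximable A -> approximable B ->
  approximable (A `|` B).
Proof.
move=> [mA hA] [mB hB]; split; first exact: measurableU.
move=> e e0; have e20 : 0 < e / 2 by rewrite divr_gt0.
have [E GE AE] := hA _ e20; have [F GF BF] := hB _ e20.
have mE := mG GE; have mF := mG GF.
exists (E `|` F); first exact: GU.
rewrite [e]splitr EFinD; apply: le_lt_trans (lteD AE BF).
apply: (@le_trans _ _ (mu (symdiff A E `|` symdiff B F))); last first.
  by apply: measureU2; exact: measurable_symdiff.
apply: le_measure; rewrite ?inE.
- by apply: measurable_symdiff; exact: measurableU.
- by apply: measurableU; exact: measurable_symdiff.
by move=> x; rewrite /symdiff /=; tauto.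
Qed.

(** The remainders [D N] decrease to the empty set, so by continuity from above of the finite
    measure [mu] a finite subunion is already close; finite unions fall under [approximableU]. *)
Lemma approximable_bigcup (F : nat -> set T) :
  (forall i, approximable (F i)) -> approximable (\bigcup_i F i).
Proof.
move=> aF; have mF i : measurable (F i) by case: (aF i).
have mU : measurable (\bigcup_i F i) by exact: bigcupT_measurable.
split => // e e0; have e20 : 0 < e / 2 by rewrite divr_gt0.
have aN N : approximable (\big[setU/set0]_(i < N) F i).
  elim: N => [|N IH]; first by rewrite big_ord0; exact: approximableG.
  by rewrite big_ord_recr; exact: approximableU.
pose D N := \bigcup_i F i `\` \big[setU/set0]_(i < N) F i.
have mD N : measurable (D N) by apply: measurableD => //; case: (aN N).
have D0 : \bigcap_N D N = set0.
  apply/seteqP; split=> // x Dx; have [[i _ Fix] _] := Dx 0%N I.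
  have [_ /=] := Dx i.+1 I; apply.
  by rewrite big_ord_recr; right.
have : mu \o D @ \oo --> mu (\bigcap_N D N).
  apply: nonincreasing_cvg_mu => //.
  - by rewrite ltey_eq fin_num_measure.
  - by rewrite D0.
  apply/nonincreasing_seqP => N; apply/subsetPset => x [Ux nx]; split => // Fx.
  by apply: nx; rewrite big_ord_recr; left.
rewrite D0 measure0 => /fine_cvgP[_ /cvgrPdist_lt /(_ _ e20)[N _ HN]].
have DN : (mu (D N) < (e / 2)%:E)%E.
  have := HN N (leqnn _); rewrite /= sub0r normrN ger0_norm ?fine_ge0//.
  by rewrite -lte_fin fineK// fin_num_measure.
apply: (approximable_step (B := \big[setU/set0]_(i < N) F i)) => //.
- by case: (aN N).
- rewrite (_ : symdiff _ _ = D N)// /symdiff.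
  rewrite [X in _ `|` X](_ : _ = set0) ?setU0//.
  apply/seteqP; split => // x [] + nx; rewrite -bigcup_mkord => -[i /= iN Fi].
  by apply: nx; exists i.
- by case: (aN N) => _; exact.
Qed.

Lemma approximable_sigma_algebra (A : set T) : <<s G >> A -> approximable A.
Proof.
apply: smallest_sub => [|B GB]; last exact: approximableG.
split; first exact: approximableG.
- by move=> B aB; rewrite setTD; exact: approximableC.
- by move=> F aF; exact: approximable_bigcup.
Qed.

End approx.

(** * Dyadic cubes *)

Section cubes.
Context {R : realType} {n : nat}.
Local Notation Rn := (Rn R n).
Local Notation leb := (leb R n).
Implicit Types (a x y : Rn) (r s : R).

(** Half-open cubes, because their dyadic subcubes partition them exactly; the closed [cube] differs
    by a null set. *)
Definition hcube a r : set Rn :=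
  [set x | forall i, pcoord a i <= pcoord x i < pcoord a i + r].

Lemma cube_box a r : cube a r =
  box (fun i => `[pcoord a i, pcoord a i + r]%classic).
Proof.
by apply/seteqP; split => x h i; have := h i; rewrite /= in_itv.
Qed.

Lemma hcube_box a r : hcube a r =
  box (fun i => `[pcoord a i, pcoord a i + r[%classic).
Proof.
by apply/seteqP; split => x h i; have := h i; rewrite /= in_itv.
Qed.

Lemma measurable_hcube a r : measurable (hcube a r).
Proof. by rewrite hcube_box; apply: measurable_Rn; apply: measurable_box. Qed.

Lemma hcube_sub a r : hcube a r `<=` cube a r.
Proof. by move=> x h i; have /andP[-> /ltW ->] := h i. Qed.

Lemma leb_cube a r : 0 <= r -> leb (cube a r) = (r ^+ n)%:E.
Proof.
move=> r0; rewrite cube_box lebE; last exact: measurable_box.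
rewrite borel_lebesgue_box//.
under eq_bigr => i _.
  rewrite lebesgue_measure_itv/= lte_fin ltrDl -EFinD addrAC subrr add0r.
  rewrite (_ : (if _ then _ else _) = r%:E); last first.
    by case: ltgtP r0 => // <-.
over.
by rewrite prodEFin big_const_ord iter_mulr_1.
Qed.

Lemma leb_hcube a r : 0 <= r -> leb (hcube a r) = (r ^+ n)%:E.
Proof.
move=> r0; rewrite hcube_box lebE; last exact: measurable_box.
rewrite borel_lebesgue_box//.
under eq_bigr => i _.
  rewrite lebesgue_measure_itv/= lte_fin ltrDl -EFinD addrAC subrr add0r.
  rewrite (_ : (if _ then _ else _) = r%:E); last first.
    by case: ltgtP r0 => // <-.
over.
by rewrite prodEFin big_const_ord iter_mulr_1.
Qed.

Lemma leb_cubeD a r : 0 <= r -> leb (cube a r `\` hcube a r) = 0%E.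
Proof.
move=> r0; rewrite measureD; [|exact: measurable_cube|exact: measurable_hcube|].
  rewrite setIidr; last exact: hcube_sub.
  by rewrite /= leb_cube// leb_hcube// subee.
by rewrite /= leb_cube// ltry.
Qed.

(** The grid of mesh [s] anchored at [a], encoded by the map sending a point to the integer index of
    its cell. Cells are then fibres, so disjointness and covering come for free. *)
Definition didx a s x : {ffun 'I_n -> int} :=
  [ffun i => Num.floor ((pcoord x i - pcoord a i) / s)].

Definition dcorner a s (z : {ffun 'I_n -> int}) : Rn :=
  [tuple pcoord a i + s * (z i)%:~R | i < n].

Lemma didx_hcube a s z : 0 < s -> didx a s @^-1` [set z] = hcube (dcorner a s z) s.
Proof.
move=> s0; have H x i : (Num.floor ((pcoord x i - pcoord a i) / s) == z i) =
   (pcoord (dcorner a s z) i <= pcoord x i < pcoord (dcorner a s z) i + s).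
  rewrite floor_eq /pcoord tnth_mktuple ler_pdivlMr// ltr_pdivrMr//.
  by rewrite intrD mulrDl mul1r [_ * s]mulrC lerBrDl ltrBlDl addrA.
apply/seteqP; split => x /=.
  by move=> xz i; rewrite -H -xz /didx ffunE.
by move=> h; apply/ffunP => i; rewrite ffunE; apply/eqP; rewrite H; exact: h.
Qed.

Lemma measurable_didx a s (P : set {ffun 'I_n -> int}) : 0 < s ->
  measurable (didx a s @^-1` P).
Proof.
move=> s0; rewrite (_ : _ @^-1` _ =
  \bigcup_z (if z \in P then didx a s @^-1` [set z] else set0)).
  apply: countable_bigcupT_measurable => // z.
  by case: ifPn => // _; rewrite didx_hcube//; exact: measurable_hcube.
apply/seteqP; split => [x Px|x [z _]].
  by exists (didx a s x) => //; rewrite mem_set.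
by case: ifPn => [/set_mem Pz /= ->|].
Qed.

(** The floor at scale [s * m.+1] is determined by the floor at scale [s], since it jumps only at
    integer multiples of [s]. *)
Lemma didx_nested a s (m : nat) x y : 0 < s -> didx a s x = didx a s y ->
  didx a (s * m.+1%:R) x = didx a (s * m.+1%:R) y.
Proof.
move=> s0 /ffunP xy; apply/ffunP => i; move: (xy i); rewrite !ffunE.
have H (t : R) k : (Num.floor (t / (s * m.+1%:R)) == k) =
  (k * m.+1%:Z <= Num.floor (t / s) < (k + 1) * m.+1%:Z).
  have sm : 0 < s * m.+1%:R by rewrite mulr_gt0.
  rewrite floor_eq floor_ge_int_tmp floor_lt_int !ler_pdivlMr// !ltr_pdivrMr//.
  by rewrite !intrM /= -!mulrA ![m.+1%:~R * s]mulrC.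
by move=> xyi; apply/eqP; rewrite H xyi -H.
Qed.

(** Arbitrary unions of cells of a single level. Levels refine one another, which makes this an
    algebra; it generates the Borel sets. *)
Definition dyadic_sets a r : set (set Rn) :=
  [set A | exists k (P : set {ffun 'I_n -> int}),
     A = didx a (r / 2 ^+ k) @^-1` P].

Lemma dyadic_sets_level a r j k (P : set {ffun 'I_n -> int}) : 0 < r ->
  (j <= k)%N -> exists P', didx a (r / 2 ^+ j) @^-1` P =
    didx a (r / 2 ^+ k) @^-1` P'.
Proof.
move=> r0 jk; exists (didx a (r / 2 ^+ k) @` (didx a (r / 2 ^+ j) @^-1` P)).
apply/seteqP; split => [x Px|x [y Py yx]]; first by exists x.
have rE : r / 2 ^+ j = r / 2 ^+ k * (2 ^ (k - j)).-1.+1%:R.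
  rewrite prednK ?expn_gt0// natrX.
  have -> : 2 ^+ k = 2 ^+ (k - j) * 2 ^+ j :> R by rewrite -exprD subnK.
  by field; rewrite !expf_neq0 ?pnatr_eq0.
by rewrite /preimage/= rE -(didx_nested _ _ yx) ?divr_gt0 ?exprn_gt0// -rE.
Qed.

Lemma dyadic_sets0 a r : dyadic_sets a r set0.
Proof. by exists 0%N, set0. Qed.

Lemma dyadic_setsC a r A : dyadic_sets a r A -> dyadic_sets a r (~` A).
Proof. by move=> [k [P ->]]; exists k, (~` P). Qed.

Lemma dyadic_setsU a r A B : 0 < r -> dyadic_sets a r A -> dyadic_sets a r B ->
  dyadic_sets a r (A `|` B).
Proof.
move=> r0 [j [P ->]] [k [Q ->]].
have [P' ->] := dyadic_sets_level a P r0 (leq_maxl j k).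
have [Q' ->] := dyadic_sets_level a Q r0 (leq_maxr j k).
by exists (maxn j k), (P' `|` Q').
Qed.

Lemma measurable_dyadic_sets a r : 0 < r -> dyadic_sets a r `<=` measurable.
Proof.
move=> r0 _ [k [P ->]]; apply: measurable_didx.
by rewrite divr_gt0// exprn_gt0.
Qed.

(** The half-space is the union over [k] of the cells of level [k] whose index in direction [i] is
    strictly beyond that of [t]; a point of it is caught once the mesh is below [pcoord x i - t]. *)
Lemma dyadic_sets_ray a r i (t : R) : 0 < r ->
  <<s dyadic_sets a r >> [set x | t < pcoord x i].
Proof.
move=> r0; pose E k : set Rn := didx a (r / 2 ^+ k) @^-1`
  [set z | Num.floor ((t - pcoord a i) / (r / 2 ^+ k)) < z i].
rewrite (_ : [set x | _] = \bigcup_k E k).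
  apply: sigma_algebra_bigcup => k; apply: sub_sigma_algebra.
  by exists k; eexists.
have s0 k : 0 < r / 2 ^+ k by rewrite divr_gt0// exprn_gt0.
apply/seteqP; split => [x /= tx|x [k _]]; last first.
  rewrite /E /= /didx ffunE; apply: contraTT; rewrite -!leNgt => xt.
  by rewrite le_floor// ler_pM2r ?invr_gt0// lerD2r.
have [k Hk] : exists k : nat, r / 2 ^+ k < pcoord x i - t.
  have d0 : 0 < (pcoord x i - t) / r by rewrite divr_gt0// subr_gt0.
  have [k _ /(_ k (leqnn _))] : \forall k \near \oo, 2^-1 ^+ k < (pcoord x i - t) / r.
    have : (fun k => 2^-1 ^+ k : R) @ \oo --> (0 : R).
      by apply: cvg_expr; rewrite ger0_norm ?invr_ge0// invf_lt1 ?ltr1n.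
    move/cvgrPdist_lt => /(_ _ d0); apply: filterS => k.
    by rewrite sub0r normrN ger0_norm// exprn_ge0// invr_ge0.
  by rewrite /= => hk; exists k; rewrite mulrC -ltr_pdivlMr// -exprVn.
exists k => //; rewrite /E /= /didx ffunE.
rewrite -lezD1 floor_ge_int_tmp intrD.
apply: (@le_trans _ _ ((t - pcoord a i) / (r / 2 ^+ k) + 1)).
  by rewrite lerD2r floor_le.
rewrite -lerBrDl -mulrBl ler_pdivlMr// mul1r.
by apply: ltW; apply: lt_le_trans Hk _; rewrite opprB addrA subrK.
Qed.

Lemma borel_dyadic a r (A : set (n.-tuple (measurableTypeR R))) : 0 < r ->
  measurable A -> <<s dyadic_sets a r >> A.
Proof.
move=> r0; apply: smallest_sub; first exact: smallest_sigma_algebra.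
rewrite -bigcup_seq => B [i _ [C mC <-]]; rewrite setTI.
have mt : measurable_fun setT
    ((fun x => pcoord x i) : g_sigma_algebraType (dyadic_sets a r) -> measurableTypeR R).
  apply: (measurability _ (RGenOInfty.measurableE R)) => //.
  move=> _ [_ [t ->] <-]; rewrite setTI.
  rewrite (_ : _ @^-1` _ = [set x | t < pcoord x i]); last first.
    by apply/seteqP; split => x; rewrite /= in_itv/= andbT.
  exact: dyadic_sets_ray.
by have := mt measurableT C mC; rewrite setTI.
Qed.

End cubes.

(** * Dyadic differentiation *)

Section le_integral_bigcup.
Context d (T : measurableType d) (R : realType) (mu : {measure set T -> \bar R}).
Local Open Scope ereal_scope.

Lemma ge0_le_integral_bigcup (F : nat -> set T) (h k : T -> \bar R) :
  (forall i, measurable (F i)) -> trivIset setT F ->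
  measurable_fun (\bigcup_i F i) h -> measurable_fun (\bigcup_i F i) k ->
  (forall x, (\bigcup_i F i) x -> 0 <= h x) ->
  (forall x, (\bigcup_i F i) x -> 0 <= k x) ->
  (forall i, \int[mu]_(x in F i) h x <= \int[mu]_(x in F i) k x) ->
  \int[mu]_(x in \bigcup_i F i) h x <= \int[mu]_(x in \bigcup_i F i) k x.
Proof.
move=> mF tF mh mk h0 k0 hk; rewrite !ge0_integral_bigcup//.
apply: lee_nneseries => // i _ _.
by apply: integral_ge0 => x Fx; apply: h0; exists i.
Qed.

End le_integral_bigcup.

Section dyadic_domination.
Context {R : realType} {n : nat}.
Local Notation Rn := (Rn R n).
Local Notation leb := (leb R n).
Implicit Types (a x y : Rn) (r s : R).
Local Open Scope ereal_scope.

(** The complete measure is the outer measure, hence an infimum over countable Borel covers; a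
    nearly optimal cover is replaced by its union. *)
Lemma leb_borel_cover (A : set Rn) (e : R) : measurable A -> leb A < +oo ->
  (0 < e)%R -> exists2 B : set Rn,
    @measurable _ (n.-tuple (measurableTypeR R)) B & A `<=` B /\ leb (B `\` A) < e%:E.
Proof.
move=> mA Aoo e0.
have Afin : leb A \is a fin_num by rewrite ge0_fin_numE ?measure_ge0.
have [_ [F [mF AF] <-] HF] := lb_ereal_inf_adherent e0 Afin.
pose B : set Rn := \bigcup_k F k.
have mB : @measurable _ (n.-tuple (measurableTypeR R)) B.
  exact: bigcupT_measurable.
exists B => //; split => //.
have leB : leb B < leb A + e%:E.
  apply: le_lt_trans HF; rewrite lebE//.
  exact: measure_sigma_subadditive.
have mB' : measurable B by exact: measurable_Rn.
have -> : leb (B `\` A) = leb B - leb A.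
  have := @measureD _ _ _ leb B A mB' mA; rewrite setIidr// => -> //.
  by rewrite (lt_trans leB)// lte_add_pinfty// ltry.
by rewrite lteBlDr// addeC.
Qed.

Definition cell a r k (z : {ffun 'I_n -> int}) : set Rn :=
  didx a (r / 2 ^+ k) @^-1` [set z].

Lemma cellE a r k z : (0 < r)%R ->
  cell a r k z = hcube (dcorner a (r / 2 ^+ k) z) (r / 2 ^+ k).
Proof. by move=> r0; rewrite /cell didx_hcube// divr_gt0// exprn_gt0. Qed.

Lemma measurable_cell a r k z : (0 < r)%R -> measurable (cell a r k z).
Proof. by move=> r0; rewrite cellE//; exact: measurable_hcube. Qed.

Lemma leb_cell a r k z : (0 < r)%R -> leb (cell a r k z) = ((r / 2 ^+ k) ^+ n)%:E.
Proof. by move=> r0; rewrite cellE// leb_hcube// divr_ge0// ?exprn_ge0// ltW. Qed.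

Lemma cell_nested a r j k z z' x : (0 < r)%R -> (j <= k)%N ->
  cell a r k z x -> cell a r j z' x -> cell a r k z `<=` cell a r j z'.
Proof.
move=> r0 jk; rewrite /cell /= => xz xz' y /= yz; rewrite -xz'.
have [P' HP] := dyadic_sets_level a [set z'] r0 jk.
have : (didx a (r / 2 ^+ j) @^-1` [set z']) x by [].
have -> : (didx a (r / 2 ^+ j) y = didx a (r / 2 ^+ j) x) =
  (didx a (r / 2 ^+ j) @^-1` [set z']) y by rewrite xz'.
by rewrite HP /= xz yz.
Qed.

Lemma hcube_cell a r : (0 < r)%R -> hcube a r = cell a r 0 [ffun=> 0%R].
Proof.
move=> r0; rewrite cellE// expr0 divr1; congr hcube.
apply: eq_from_tnth => i; rewrite tnth_mktuple ffunE mulr0 addr0.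
by [].
Qed.

Variables (a : Rn) (r lam : R) (g : Rn -> R).
Hypotheses (r0 : (0 < r)%R) (lam0 : (0 <= lam)%R) (g0 : forall x, (0 <= g x)%R)
  (ig : leb.-integrable setT (EFin \o g)).

Let mg (A : set Rn) : measurable A -> measurable_fun A (EFin \o g).
Proof. by move=> mA; apply: measurable_funTS; case/integrableP: ig. Qed.

Lemma le_integral_leb_bigcup (F : nat -> set Rn) :
  (forall i, measurable (F i)) -> trivIset setT F ->
  (forall i, \int[leb]_(x in F i) (g x)%:E <= lam%:E * leb (F i)) ->
  \int[leb]_(x in \bigcup_i F i) (g x)%:E <= lam%:E * leb (\bigcup_i F i).
Proof.
move=> mF tF hF.
have mU : measurable (\bigcup_i F i) by exact: bigcupT_measurable.
rewrite -integral_cst; last exact: mU.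
apply: ge0_le_integral_bigcup;
  [exact: mF|exact: tF|exact: mg|exact: measurable_cst| | |].
- by move=> x _; rewrite lee_fin g0.
- by move=> x _; rewrite /cst lee_fin.
- by move=> i; rewrite integral_cst.
Qed.

(** [hcube a r] is a cell of level 0, so a cell of level [k] meeting it lies inside it; the domain
    of integration is thus a countable disjoint union of cells to which the hypothesis applies. *)
Lemma le_integral_level k (P : set {ffun 'I_n -> int}) :
  (forall z, cell a r k z `<=` hcube a r ->
    \int[leb]_(x in cell a r k z) (g x)%:E <= lam%:E * leb (cell a r k z)) ->
  \int[leb]_(x in didx a (r / 2 ^+ k) @^-1` P `&` hcube a r) (g x)%:E <=
  lam%:E * leb (didx a (r / 2 ^+ k) @^-1` P `&` hcube a r).
Proof.
move=> hcell.
pose F i : set Rn := if @pickle_inv {ffun 'I_n -> int} i is Some z then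
  if `[< P z /\ cell a r k z `<=` hcube a r >] then cell a r k z else set0
  else set0.
have -> : didx a (r / 2 ^+ k) @^-1` P `&` hcube a r = \bigcup_i F i.
  apply/seteqP; split => [x [Px xQ]|x [i _]].
    exists (pickle (didx a (r / 2 ^+ k) x)) => //.
    rewrite /F pickleK_inv asboolT//; split => //.
    by move: xQ; rewrite hcube_cell// => xQ; apply: cell_nested xQ.
  by rewrite /F; case: pickle_inv => // z; case: asboolP => // -[Pz zQ] xz;
    split; [rewrite /preimage /= xz|exact: zQ].
apply: le_integral_leb_bigcup => [i||i].
- rewrite /F; case: pickle_inv => // z; case: ifPn => // _.
  exact: measurable_cell.
- apply/trivIsetP => i j _ _; apply: contraNeq => /set0P[x []].
  rewrite /F.
  have := @pickle_invK {ffun 'I_n -> int} i.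
  have := @pickle_invK {ffun 'I_n -> int} j.
  case: pickle_inv => [z /= <-|//]; case: pickle_inv => [z' /= <-|//].
  case: ifPn => // _; case: ifPn => // _; by rewrite /cell/= => -> ->.
- rewrite /F; case: pickle_inv => [z|]; last by rewrite integral_set0 measure0 mule0.
  case: asboolP => [[_ zQ]|_]; last by rewrite integral_set0 measure0 mule0.
  exact: hcell.
Qed.

Hypothesis hcell : forall k z, cell a r k z `<=` hcube a r ->
  \int[leb]_(x in cell a r k z) (g x)%:E <= lam%:E * leb (cell a r k z).

Lemma le_integral_dyadic_sets (E : set Rn) : dyadic_sets a r E ->
  \int[leb]_(x in E `&` hcube a r) (g x)%:E <= lam%:E * leb (E `&` hcube a r).
Proof. by move=> [k [P ->]]; apply: le_integral_level => z; exact: hcell. Qed.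

(** Stands in for Lebesgue differentiation. The set is approximated by a Borel superset and that one
    by a dyadic set, for which the bound is a sum over cells; absolute continuity of the integral
    controls the mass of [g] that is missed. *)
Lemma dyadic_dominated (A : set Rn) : measurable A -> A `<=` hcube a r ->
  \int[leb]_(x in A) (g x)%:E <= lam%:E * leb A.
Proof.
move=> mA AQ; have mQ := measurable_hcube a r.
have Qoo : leb (hcube a r) < +oo by rewrite leb_hcube ?ltry// ltW.
have Aoo : leb A < +oo.
  by apply: le_lt_trans Qoo; apply: le_measure; rewrite ?inE.
apply/lee_addgt0Pr => e e0.
have e20 : (0 < e / 2)%R by rewrite divr_gt0.
have [d [d0 Hd]] := integral_normr_continuous ig e20.
(* [d] keeps the integral of [g] over the missed part below [e / 2]; the second bound makes the
   excess measure [2 * t] cost at most [e / 2] after multiplication by [lam]. The [+ 1] guards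
   against [lam = 0]. *)
pose t := Num.min d (e / (4 * (lam + 1)))%R.
have l1 : (0 < 4 * (lam + 1))%R by rewrite mulr_gt0// ltr_wpDl.
have t0 : (0 < t)%R by rewrite lt_min d0/= divr_gt0.
have [B mB [AB BA]] := leb_borel_cover mA Aoo t0.
have mB' : measurable B by exact: measurable_Rn.
have [_ /(_ _ t0)[E GE BE]] := @approximable_sigma_algebra _ _ R (mfrestr mQ Qoo) _
  (dyadic_sets0 a r) (@dyadic_setsC _ _ a r)
  (fun A B => @dyadic_setsU _ _ a r A B r0) (measurable_dyadic_sets r0)
  _ (@borel_dyadic _ _ a _ _ r0 mB).
have mE := measurable_dyadic_sets r0 GE.
have {}BE : leb (symdiff B E `&` hcube a r) < t%:E by [].
have mEQ : measurable (E `&` hcube a r) by exact: measurableI.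
have mS : measurable (symdiff B E `&` hcube a r).
  by apply: measurableI => //; exact: measurable_symdiff.
have mAE : measurable (A `\` (E `&` hcube a r)) by exact: measurableD.
have mBA : measurable (B `\` A) by exact: measurableD.
have H1 : \int[leb]_(x in A `\` (E `&` hcube a r)) (g x)%:E <= (e / 2)%:E.
  have iD : leb.-integrable (A `\` (E `&` hcube a r)) (EFin \o g).
    exact: integrableS ig.
  rewrite -[leLHS]fineK ?integrable_fin_num// lee_fin ltW//.
  have -> : fine (\int[leb]_(x in A `\` (E `&` hcube a r)) (g x)%:E) =
      (\int[leb]_(x in A `\` (E `&` hcube a r)) `|g x|)%R.
    by rewrite /Rintegral; congr fine; apply: eq_integral => x _; rewrite ger0_norm.
  apply: Hd => //; apply: le_lt_trans (lt_le_trans BE _); last first.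
    by rewrite lee_fin ge_min lexx.
  apply: le_measure; rewrite ?inE// => x [Ax nx]; split; last exact: AQ.
  by left; split; [exact: AB|move=> Ex; apply: nx; split => //; exact: AQ].
have H2 : leb (E `&` hcube a r) <= leb A + (2 * t)%:E.
  have H3 : leb (E `&` hcube a r) <=
      leb (A `|` ((B `\` A) `|` (symdiff B E `&` hcube a r))).
    apply: le_measure; rewrite ?inE//.
      by apply: measurableU => //; exact: measurableU.
    move=> x [Ex Qx]; have [Ax|nAx] := pselect (A x); first by left.
    right; have [Bx|nBx] := pselect (B x); first by left.
    by right; split => //; right.
  apply: le_trans H3 _; apply: le_trans (measureU2 _ _ _) _ => //.
    exact: measurableU.
  rewrite leeD2l//; apply: le_trans (measureU2 _ _ _) _ => //.
  by rewrite mulrDl mul1r EFinD leeD// ltW.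
have H4 : \int[leb]_(x in A) (g x)%:E <= \int[leb]_(x in E `&` hcube a r) (g x)%:E
   + \int[leb]_(x in A `\` (E `&` hcube a r)) (g x)%:E.
  have mU := measurableU _ _ mEQ mAE.
  rewrite -ge0_integral_setU; [|exact: mEQ|exact: mAE|exact: mg| |]; last 2 first.
  - by move=> x _; rewrite lee_fin g0.
  - by rewrite disj_set2E setDIK.
  apply: ge0_subset_integral; [exact: mA|exact: mU|exact: mg| |].
  - by move=> x _; rewrite lee_fin g0.
  - by move=> x Ax; have [?|?] := pselect ((E `&` hcube a r) x); [left|right].
apply: le_trans H4 _.
have -> : e = (e / 2 + e / 2)%R by rewrite -splitr.
rewrite EFinD [leRHS]addeA; apply: leeD => //.
apply: (@le_trans _ _ (lam%:E * leb (E `&` hcube a r))).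
  exact: le_integral_dyadic_sets.
apply: (@le_trans _ _ (lam%:E * (leb A + (2 * t)%:E))).
  by rewrite lee_wpmul2l ?lee_fin.
rewrite muleDr// ?leeD2l//; last by rewrite ge0_adde_def// inE ?lee_fin// mulr_ge0// ltW.
rewrite -EFinM lee_fin.
have : (t <= e / (4 * (lam + 1)))%R by rewrite ge_min lexx orbT.
rewrite ler_pdivlMr// => h; have : (t * lam <= t * (lam + 1))%R by rewrite ler_pM2l// lerDl.
nra.
Qed.

End dyadic_domination.

(** * The Calderon-Zygmund decomposition *)

Section calderon_zygmund.
Context {R : realType} {n : nat}.
Local Notation Rn := (Rn R n).
Local Notation leb := (leb R n).
Local Open Scope ereal_scope.
Variables (a : Rn) (r lam : R) (g : Rn -> R).
Hypotheses (r0 : (0 < r)%R) (lam0 : (0 < lam)%R) (g0 : forall x, (0 <= g x)%R)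
  (ig : leb.-integrable setT (EFin \o g)).

Let idx k := didx a (r / 2 ^+ k).
Local Notation cell := (cell a r).

Let heavy k z := lam%:E * leb (cell k z) < \int[leb]_(x in cell k z) (g x)%:E.

(** The stopping cells of the decomposition. As cells nest, [idx j x] for [j < k] is the index of
    the ancestor of level [j], so the last clause expresses maximality. *)
Let stops k z := [/\ cell k z `<=` hcube a r, heavy k z &
  forall j x, (j < k)%N -> cell k z x -> ~ heavy j (idx j x)].

Let D i : set Rn :=
  if @pickle_inv (nat * {ffun 'I_n -> int})%type i is Some (k, z)
  then if `[< stops k z >] then cell k z else set0 else set0.

Let DP i x : D i x -> exists k z, [/\ i = pickle (k, z), stops k z,
  D i = cell k z & cell k z x].
Proof.
rewrite /D; have := @pickle_invK (nat * {ffun 'I_n -> int})%type i.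
case: pickle_inv => // -[k z] /= iE; case: asboolP => // kz xz.
by exists k, z; split.
Qed.

(** Among the heavy cells around [x], the one of least level is a stopping cell. *)
Let stops_heavy k x : hcube a r x -> heavy k (idx k x) -> (\bigcup_i D i) x.
Proof.
move=> Qx hk; have ex : exists j, `[< heavy j (idx j x) >].
  by exists k; apply/asboolP.
have [j /asboolP hj minj] := ex_minnP ex.
have sj : stops j (idx j x).
  split => //.
    by move: Qx; rewrite hcube_cell// => Qx; apply: cell_nested Qx.
  move=> i y ij yx hi; suff : (j <= i)%N by rewrite leqNgt ij.
  apply: minj; apply/asboolP; move: hi; congr heavy.
  by have := @cell_nested _ _ a r i j _ (idx i x) x r0 (ltnW ij) erefl erefl y yx.
by exists (pickle (j, idx j x)) => //; rewrite /D pickleK_inv asboolT.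
Qed.

Let mD i : measurable (D i).
Proof.
rewrite /D; case: pickle_inv => // -[k z]; case: ifPn => // _.
exact: measurable_cell.
Qed.

(** Two stopping cells that meet are comparable, and the coarser one would be a heavy ancestor of
    the finer. *)
Let tD : trivIset setT D.
Proof.
apply/trivIsetP => i j _ _; apply: contraNeq => /set0P[x [Di Dj]].
have [k [z [-> [_ hk sk] _ xz]]] := DP Di.
have [k' [z' [-> [_ hk' sk'] _ xz']]] := DP Dj.
have E : idx k x = z by []. have E' : idx k' x = z' by [].
have [kk|kk|kk] := ltngtP k k'.
- by case: (sk' _ _ kk xz'); rewrite E.
- by case: (sk _ _ kk xz); rewrite E'.
by rewrite -E -E' kk.
Qed.

Let mg (A : set Rn) : measurable A -> measurable_fun A (EFin \o g).
Proof. by move=> mA; apply: measurable_funTS; case/integrableP: ig. Qed.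

(** [dyadic_dominated] is applied to [g] cut off to the part of the cube outside the [D i]. On a
    light cell the cut-off only lowers the integral, and a heavy cell is covered by the [D i], where
    the cut-off vanishes. *)
Let light_off (A : set Rn) : measurable A -> A `<=` hcube a r `\` \bigcup_i D i ->
  \int[leb]_(x in A) (g x)%:E <= lam%:E * leb A.
Proof.
move=> mA AB; set B := hcube a r `\` \bigcup_i D i in AB.
have mB : measurable B.
  by apply: measurableD; [exact: measurable_hcube|exact: bigcupT_measurable].
pose g' x := (g x * \1_B x)%R.
have g'0 x : (0 <= g' x)%R by rewrite mulr_ge0.
have g'g x : (g' x <= g x)%R by rewrite /g' indicE; case: (_ \in _); rewrite ?mulr1 ?mulr0.
have mg' : measurable_fun setT (EFin \o g').
  apply/measurable_EFinP; apply: measurable_funM; last exact: measurable_indic.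
  by apply/measurable_EFinP; exact: mg.
have ig' : leb.-integrable setT (EFin \o g').
  apply: le_integrable ig => // x _ /=.
  by rewrite lee_fin !ger0_norm.
have -> : \int[leb]_(x in A) (g x)%:E = \int[leb]_(x in A) (g' x)%:E.
  apply: eq_integral => x /set_mem /AB Bx.
  by rewrite /g' indicE mem_set// mulr1.
apply: (@dyadic_dominated _ _ a r lam g' r0 (ltW lam0) g'0 ig') => //; last first.
  by move=> x /AB [].
move=> k z zQ; have mc := measurable_cell a k z r0.
have [|hk] := leP (\int[leb]_(x in cell k z) (g x)%:E) (lam%:E * leb (cell k z)).
  apply: le_trans.
  apply: ge0_le_integral; [exact: mc| | |exact: mg|].
  - by move=> x _; rewrite lee_fin.
  - exact: measurable_funTS.
  - by move=> x _; rewrite lee_fin.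
rewrite (eq_integral (cst 0)).
  by rewrite integral0 mule_ge0// lee_fin ltW.
move=> x /set_mem xz; rewrite /g' indicE memNset ?mulr0// => -[Qx]; apply.
by apply: (@stops_heavy k) => //; have -> : idx k x = z by [].
Qed.

(** Each stopping cell is heavy, while its parent, [2 ^+ n] times as large, is light by maximality:
    this gives the two-sided bound on the means. *)
Lemma calderon_zygmund :
  \int[leb]_(x in hcube a r) (g x)%:E <= lam%:E * leb (hcube a r) ->
  exists D : nat -> set Rn, [/\ forall i, measurable (D i), trivIset setT D,
    \bigcup_i D i `<=` hcube a r,
    forall i, D i = set0 \/ exists b s, [/\ (0 < s)%R, D i = hcube b s,
      lam%:E * leb (D i) <= \int[leb]_(x in D i) (g x)%:E &
      \int[leb]_(x in D i) (g x)%:E <= (2 ^+ n * lam)%:E * leb (D i)] &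
    {ae leb, forall x, (hcube a r `\` \bigcup_i D i) x -> (g x <= lam)%R}].
Proof.
move=> Qlam; exists D; split => //.
- by move=> x [i _ /DP[k [z [_ [zQ _ _] _ xz]]]]; exact: zQ.
- move=> i; have [->|/set0P[x Dx]] := eqVneq (D i) set0; [by left|right].
  have [k [z [_ [zQ hz sz] -> xz]]] := DP Dx.
  exists (dcorner a (r / 2 ^+ k) z), (r / 2 ^+ k)%R; split.
  + by rewrite divr_gt0// exprn_gt0.
  + by rewrite cellE.
  + exact: ltW.
  (* Level 0 cannot stop: its only cell in the cube is the cube itself, which is light by
     assumption. At level [k.+1] there is a parent to compare with. *)
  case: k Dx zQ hz sz xz => [|k] Dx zQ hz sz xz.
    have E : hcube a r = cell 0 z.
      have Qx := zQ _ xz; apply/seteqP; split => //.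
      by rewrite hcube_cell// in Qx *; apply: cell_nested xz.
    by move: hz; rewrite /heavy ltNge -E Qlam.
  have := sz k x (ltnSn k) xz => /negP; rewrite -leNgt => h.
  apply: (@le_trans _ _ (\int[leb]_(x in cell k (idx k x)) (g x)%:E)).
    apply: ge0_subset_integral; try exact: measurable_cell.
    + by apply: mg; exact: measurable_cell.
    + by move=> y _; rewrite lee_fin g0.
    + exact: cell_nested xz _.
  apply: le_trans h _; rewrite !leb_cell// -!EFinM lee_fin.
  rewrite mulrAC -exprMn mulrC le_eqVlt; apply/orP; left; apply/eqP.
  congr ((_ ^+ _) * _)%R.
  by rewrite exprS; field; rewrite expf_neq0.
set B := hcube a r `\` \bigcup_i D i.
have mB : measurable B.
  by apply: measurableD; [exact: measurable_hcube|exact: bigcupT_measurable].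
(* If [g] reached [lam + 1/(m+1)] on a set of positive measure outside the [D i], its integral there
   would violate [light_off]. *)
pose A m := B `&` [set x | (lam + m.+1%:R^-1 <= g x)%R].
have mA m : measurable (A m).
  rewrite /A (_ : [set x | _] = (EFin \o g) @^-1` `[(lam + m.+1%:R^-1)%:E, +oo[).
    apply: measurableI => //; rewrite -[X in measurable X]setTI.
    by apply: mg => //; exact: emeasurable_itv.
  by apply/seteqP; split => x /=; rewrite in_itv /= lee_fin andbT.
have A0 m : leb (A m) = 0.
  apply/eqP; rewrite -measure_le0 leNgt; apply/negP => pA.
  have Aoo : leb (A m) < +oo.
    apply: (@le_lt_trans _ _ (leb (hcube a r))).
      by apply: le_measure; rewrite ?inE//; [exact: measurable_hcube|move=> x [[]]].
    by rewrite leb_hcube ?ltry// ltW.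
  have := light_off (mA m) (@subIsetl _ _ _); rewrite leNgt => /negP; apply.
  apply: (@lt_le_trans _ _ ((lam + m.+1%:R^-1)%:E * leb (A m))).
    by rewrite lte_pmul2r ?ge0_fin_numE// lte_fin ltrDl invr_gt0.
  rewrite -integral_cst; last exact: mA.
  apply: ge0_le_integral; [exact: mA| |exact: measurable_cst|exact: mg|].
  - by move=> x _; rewrite /cst lee_fin addr_ge0// ltW.
  - by move=> x [_ /=]; rewrite lee_fin.
have : leb.-negligible (\bigcup_m A m).
  by apply: negligible_bigcup => m; exists (A m); split; [exact: mA|exact: A0|exact: subset_refl].
apply: negligibleS => x /= /not_implyP[Bx /negP]; rewrite -ltNge => lx.
have [m mx] := ltr_add_invr lx.
by exists m => //; split => //=; exact: ltW.
Qed.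

End calderon_zygmund.

(** * The functions psi_N and the Gamma function *)

Section gamma.
Context {R : realType}.
Implicit Types (p q u v : R).

Lemma powR_oo_LRcontinuous q u v : 0 < q -> 0 <= u -> u < v ->
  derivable_oo_LRcontinuous (@powR R ^~ q) u v.
Proof.
move=> q0 u0 uv.
have cont t : 0 < t -> {for t, continuous (@powR R ^~ q)}.
  move=> t0; apply: differentiable_continuous; apply/derivable1_diffP.
  by apply: derivable_powR; rewrite in_itv/= andbT.
split.
- move=> t; rewrite in_itv/= => /andP[ut _]; apply: derivable_powR.
  by rewrite in_itv/= andbT (le_lt_trans u0).
- have [->|un0] := eqVneq u 0; first by rewrite powR0 ?gt_eqF//; exact: powR_cvg0.
  by apply: cvg_at_right_filter; apply: cont; rewrite lt_neqAle eq_sym un0.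
- by apply: cvg_at_left_filter; apply: cont; exact: le_lt_trans uv.
Qed.

Lemma integral_powRB1 p u v : 1 < p -> 0 <= u -> u < v ->
  (\int[lebesgue_measure]_(t in `[u, v]) (p * t `^ (p - 1))%:E =
   (v `^ p - u `^ p)%:E)%E.
Proof.
move=> p1 u0 uv; rewrite (@continuous_FTC2 _ _ (@powR R ^~ p))//.
- have : {within `[u, v], continuous (@powR R ^~ (p - 1))}.
    apply: derivable_oo_LRcontinuous_within; apply: powR_oo_LRcontinuous => //.
    by rewrite subr_gt0.
  move=> h x; apply: cvgM; [exact: cvg_cst|exact: h].
- by apply: powR_oo_LRcontinuous => //; exact: lt_trans p1.
- move=> t; rewrite in_itv/= => /andP[ut _].
  by rewrite powR_derive1// in_itv/= andbT (le_lt_trans u0).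
Qed.

Definition gammaF p (t : R) : R := t `^ (p - 1) * expR (- t).

Lemma gammaF_ge0 p t : 0 <= gammaF p t.
Proof. by rewrite mulr_ge0 ?powR_ge0// expR_ge0. Qed.

Lemma measurable_gammaF p (A : set R) :
  measurable_fun A (EFin \o gammaF p : R -> \bar R).
Proof.
apply: measurable_funTS; apply/measurable_EFinP; apply: measurable_funM.
  exact: measurable_powR.
apply: (@measurableT_comp _ _ _ _ _ _ expR); first exact: measurable_expR.
exact: oppr_measurable.
Qed.

(** For [t <= v] the factor [expR (v - t)] is at least 1; inserting it into the integral of the
    derivative of the power produces the Gamma integrand. *)
Lemma powRB_le_gamma p u v : 1 < p -> 0 <= u -> u < v ->
  ((v `^ p - u `^ p)%:E <=
   (expR v * p)%:E * \int[lebesgue_measure]_(t in `]u, v]) (gammaF p t)%:E)%E.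
Proof.
move=> p1 u0 uv; rewrite -integral_powRB1//.
rewrite -[X in (X <= _)%E](@integral_itv_obnd_cbnd _ _ (BRight v)); last first.
  apply/measurable_EFinP; apply: measurable_funM => //.
  by apply: measurable_funTS; exact: measurable_powR.
have p0 : 0 < p by exact: lt_trans p1.
rewrite -ge0_integralZl//; last 3 first.
- exact: measurable_gammaF.
- by move=> t _; rewrite lee_fin gammaF_ge0.
- by rewrite lee_fin mulr_ge0 ?expR_ge0 ?ltW.
apply: ge0_le_integral => //.
- by move=> t _; rewrite lee_fin mulr_ge0 ?powR_ge0 ?ltW.
- apply/measurable_EFinP; apply: measurable_funM => //.
  by apply: measurable_funTS; exact: measurable_powR.
- apply: measurable_funeM; exact: measurable_gammaF.
move=> t /=; rewrite in_itv/= => /andP[ut tv].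
rewrite -EFinM lee_fin /gammaF.
have -> : expR v * p * (t `^ (p - 1) * expR (- t)) =
  p * t `^ (p - 1) * expR (v - t) by rewrite expRD; ring.
rewrite ler_peMr// ?mulr_ge0 ?powR_ge0// ?(ltW p0)//.
by rewrite -expR0 ler_expR subr_ge0.
Qed.

(** The integrand is dominated by [2 * C] times the exponential density of rate 1/2, whose integral
    is 1. *)
Lemma gamma_fin p : 1 < p ->
  (\int[lebesgue_measure]_(t in `]0%R, +oo[) (gammaF p t)%:E < +oo)%E.
Proof.
move=> p1; set m := Num.truncn p.
have pm : p < m.+1%:R by exact: truncnS_gt.
(* The term 1 serves [t <= 1]; the other comes from keeping only the term of degree [m.+1 > p] in
   the exponential series of [t / 2]. *)
pose C : R := 1 + 2 ^+ m.+1 * (m.+1)`!%:R.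
have C0 : 0 <= C by rewrite addr_ge0// mulr_ge0// exprn_ge0.
have h2 : (0 : R) < 2^-1 by rewrite invr_gt0.
have mpdf : measurable_fun setT (EFin \o exponential_pdf (2^-1 : R)).
  by apply/measurable_EFinP; exact: measurable_exponential_pdf.
have pdf0 t : (0 <= (exponential_pdf (2^-1 : R) t)%:E)%E.
  by rewrite lee_fin exponential_pdf_ge0// ltW.
apply: (@le_lt_trans _ _ (\int[lebesgue_measure]_t
    ((2 * C)%:E * (exponential_pdf (2^-1 : R) t)%:E))%E); last first.
  rewrite ge0_integralZl//; last by rewrite lee_fin mulr_ge0.
  by rewrite integral_exponential_pdf// mule1 ltry.
apply: (@le_trans _ _ (\int[lebesgue_measure]_(t in `]0%R, +oo[)
    ((2 * C)%:E * (exponential_pdf (2^-1 : R) t)%:E))%E); last first.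
  apply: ge0_subset_integral => //; first exact: measurable_funeM.
  by move=> t _; rewrite mule_ge0// lee_fin mulr_ge0.
apply: ge0_le_integral => //.
- by move=> t _; rewrite lee_fin gammaF_ge0.
- exact: measurable_gammaF.
- by apply: measurable_funeM; exact: measurable_funTS.
move=> t /=; rewrite in_itv/= andbT => t0; rewrite -EFinM lee_fin.
have -> : exponential_pdf 2^-1 t = 2^-1 * expR (- 2^-1 * t).
  by rewrite /exponential_pdf patchE mem_set//= in_itv/= andbT ltW.
have -> : 2 * C * (2^-1 * expR (- 2^-1 * t)) = C * expR (2^-1 * t) * expR (- t).
  by rewrite -[RHS]mulrA -expRD (_ : 2^-1 * t - t = - 2^-1 * t); field.
rewrite /gammaF ler_pM2r ?expR_gt0//.
have e1 : 1 <= expR (2^-1 * t) by rewrite -expR0 ler_expR mulr_ge0// ltW.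
have [t1|t1] := leP t 1.
  apply: (@le_trans _ _ 1).
    apply: (@le_trans _ _ (1 `^ (p - 1))); last by rewrite powR1.
    by rewrite ge0_ler_powR ?nnegrE ?(ltW t0)// subr_ge0 ltW.
  by rewrite -[leLHS]mulr1 ler_pM// lerDl mulr_ge0// exprn_ge0.
apply: (@le_trans _ _ (t ^+ m.+1)).
  by rewrite -powR_mulrn ?(ltW t0)// ler_powR ?(ltW t1)// lerBlDr ltW// ltr_wpDr.
have := @expR_ge1Dxn _ (2^-1 * t) m (mulr_ge0 (ltW h2) (ltW t0)).
set e := expR _ => he.
apply: (@le_trans _ _ (2 ^+ m.+1 * m.+1`!%:R * e)); last first.
  by rewrite ler_wpM2r// ?(le_trans _ e1)// lerDr.
have f0 : 0 < m.+1`!%:R :> R by rewrite ltr0n fact_gt0.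
have {}he : (2^-1 * t) ^+ m.+1 <= e * m.+1`!%:R.
  by rewrite -ler_pdivrMr//; apply: le_trans he; rewrite lerDr.
rewrite -mulrA [_ * e]mulrC; apply: le_trans (ler_wpM2l _ he); last exact: exprn_ge0.
by rewrite -exprMn mulrA mulfV// mul1r.
Qed.

Lemma EFin_Gamma p : 1 < p ->
  (\int[lebesgue_measure]_(t in `]0%R, +oo[) (gammaF p t)%:E = (Gamma p)%:E)%E.
Proof.
move=> p1; rewrite /Gamma /Rintegral fineK//.
rewrite ge0_fin_numE ?gamma_fin//.
by apply: integral_ge0 => t _; rewrite lee_fin gammaF_ge0.
Qed.

(* Only the exponential weight [expR (- t) >= expR (- v)] on each interval of
   length at most 1 is lost when the sum is compared with the Gamma integral. *)
Lemma sum_powRB_le_gamma p N : 1 < p ->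
  ((2^-1 `^ p + \sum_(k < N) expR (- k.+1%:R) *
     ((k.+1%:R + 2^-1) `^ p - (k%:R + 2^-1) `^ p))%:E <=
   (expR 2^-1 * p)%:E *
     \int[lebesgue_measure]_(t in `]0%R, (N%:R + 2^-1)%R]) (gammaF p t)%:E)%E.
Proof.
move=> p1; have p0 : 0 < p by exact: lt_trans p1.
elim: N => [|N IH].
  rewrite big_ord0 addr0 add0r.
  have := @powRB_le_gamma p 0 2^-1 p1 (lexx _).
  by rewrite powR0 ?gt_eqF// subr0; apply; rewrite invr_gt0.
rewrite big_ord_recr/= addrA EFinD.
have N0 : 0 <= N%:R + 2^-1 :> R by rewrite addr_ge0.
have N1 : N%:R + 2^-1 < N.+1%:R + 2^-1 :> R by rewrite ltrD2r ltr_nat.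
have -> : `]0%R, (N.+1%:R + 2^-1)%R]%classic = `]0%R, (N%:R + 2^-1)%R]%classic `|`
    `](N%:R + 2^-1)%R, (N.+1%:R + 2^-1)%R]%classic :> set R.
  apply/seteqP; split => t /=; rewrite !in_itv/=.
    move=> /andP[t0 tN]; have [tN'|tN'] := leP t (N%:R + 2^-1).
      by left; rewrite t0.
    by right.
  move=> [|] /andP[t0 tN]; first by rewrite t0 (le_trans tN)// ltW.
  by rewrite (le_lt_trans _ t0).
rewrite ge0_integral_setU//; last 3 first.
- exact: measurable_gammaF.
- by move=> t _; rewrite lee_fin gammaF_ge0.
- apply/disj_setPS => t /= []; rewrite !in_itv/= => /andP[_ h] /andP[h' _].
  by move: (lt_le_trans h' h); rewrite ltxx.
rewrite ge0_muleDr//; try by apply: integral_ge0 => t _; rewrite lee_fin gammaF_ge0.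
apply: leeD; first exact: IH.
rewrite EFinM.
apply: (@le_trans _ _ ((expR (- N.+1%:R))%:E * ((expR (N.+1%:R + 2^-1) * p)%:E *
  \int[lebesgue_measure]_(t in `](N%:R + 2^-1)%R, (N.+1%:R + 2^-1)%R]) (gammaF p t)%:E))%E).
  by apply: lee_wpmul2l; [rewrite lee_fin expR_ge0|exact: powRB_le_gamma].
rewrite muleA -EFinM mulrA -expRD addrA [- _ + _]addrC subrr add0r.
exact: lexx.
Qed.

(** The summand of index [k] models generation [k] of the stopping cubes: [expR (- k)] for the
    measure they occupy, [y + k + 1/2] for the normalised height of the function there. Subtracting
    the value at [y = 0] makes the sum vanish at 0. *)
Definition psi p N (y : R) : R :=
  \sum_(k < N) expR (- k%:R) * ((y + k%:R + 2^-1) `^ p - (k%:R + 2^-1) `^ p).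

Lemma psi0 p N : psi p N 0 = 0.
Proof. by rewrite /psi big1// => k _; rewrite add0r subrr mulr0. Qed.

Lemma psi_le p N x y : 1 < p -> 0 <= x -> x <= y -> psi p N x <= psi p N y.
Proof.
move=> p1 x0 xy; apply: ler_sum => k _; rewrite ler_wpM2l ?expR_ge0// lerD2r.
have y0 : 0 <= y by exact: le_trans xy.
rewrite ge0_ler_powR ?nnegrE ?addr_ge0// ?lerD2r//.
by rewrite ltW// (lt_trans _ p1).
Qed.

Lemma psi_ge0 p N y : 1 < p -> 0 <= y -> 0 <= psi p N y.
Proof. by move=> p1 y0; rewrite -(psi0 p N) psi_le. Qed.

(* convexity of [fun y => (y + b) `^ p], which vanishes at 0 after subtracting
   [b `^ p], makes its perspective nonincreasing *)
Lemma psi_perspective p N (al a a' : R) : 1 < p -> 0 <= al -> 0 < a -> a <= a' ->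
  a' * psi p N (al / a') <= a * psi p N (al / a).
Proof.
move=> p1 al0 a0 aa'; rewrite /psi !mulr_sumr; apply: ler_sum => k _.
have a'0 : 0 < a' by exact: lt_le_trans aa'.
rewrite !(mulrCA _ (expR _)) ler_wpM2l ?expR_ge0//.
rewrite -!addrA; set b := k%:R + 2^-1.
have b0 : 0 <= b by rewrite addr_ge0.
pose t := a / a'.
have t0 : 0 <= t by rewrite divr_ge0 ?ltW.
have t1 : t <= 1 by rewrite ler_pdivrMr// mul1r.
have y0 : 0 <= al / a + b by rewrite addr_ge0// divr_ge0// ltW.
have := convex_powR (ltW p1) (Itv01 t0 t1) (x := al / a + b) (y := b).
rewrite !inE/= !in_itv/= !andbT => /(_ y0 b0).
rewrite !convRE /= /unstable.onem => cvx.
have : (t * (al / a + b) + (1 - t) * b) `^ p <=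
  t * (al / a + b) `^ p + (1 - t) * b `^ p by exact: cvx.

have -> : t * (al / a + b) + (1 - t) * b = al / a' + b.
  by rewrite /t; field; rewrite !gt_eqF.
set P := (al / a + b) `^ p; set Q := b `^ p => h.
have -> : a * (P - Q) = a' * (t * (P - Q)).
  by rewrite /t; field; rewrite gt_eqF.
rewrite ler_pM2l// lerBlDr; apply: le_trans h _.
by lra.
Qed.

(** The left side is what one stopping step produces: the power outside the stopping cubes, and a
    shift of the height by 1 on a fraction [expR (- 1)] of the measure. Reindexing leaves
    [psi p N.+1 y] and a term free of [y]. *)
Lemma psiS p N y : (y + 2^-1) `^ p + expR (- 1) * psi p N (y + 1) =
  psi p N.+1 y + (2^-1 `^ p + expR (- 1) * psi p N 1).
Proof.
pose S := \sum_(k < N) expR (- k.+1%:R) *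
  ((y + k.+1%:R + 2^-1) `^ p - (k.+1%:R + 2^-1) `^ p).
have -> : psi p N.+1 y = (y + 2^-1) `^ p - 2^-1 `^ p + S.
  rewrite /psi big_ord_recl/= oppr0 expR0 mul1r addr0 add0r; congr (_ + _).
have -> : expR (- 1) * psi p N (y + 1) = S + expR (- 1) * psi p N 1; last by ring.
rewrite /psi !mulr_sumr -big_split/=; apply: eq_bigr => k _.
have -> : k.+1%:R = k%:R + 1 :> R by rewrite natr1.
have -> : y + 1 + k%:R + 2^-1 = y + (k%:R + 1) + 2^-1 by ring.
have -> : 1 + k%:R + 2^-1 = k%:R + 1 + 2^-1 :> R by ring.
by rewrite opprD expRD; ring.
Qed.

(** With [x = expR 2^-1] this reads [x <= x^2 - 1], true for [x] above the golden ratio 1.618...;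
    the bound [(1 + 1/16)^8 > 1.62] is just enough. *)
Lemma exp_half : expR 2^-1 <= (1 - expR (- 1)) * expR 1 :> R.
Proof.
have h : 1 + 16%:R^-1 <= expR (16%:R^-1 : R) by exact: expR_ge1Dx.
set x := expR (2^-1 : R).
have xE : x = expR 16%:R^-1 ^+ 8.
  by rewrite /x -expRM_natl; congr expR; field.
have e1 : expR 1 = x ^+ 2 :> R.
  by rewrite /x -expRM_natl; congr expR; field.
have hx : (1 + 16%:R^-1) ^+ 8 <= x.
  by rewrite xE lerXn2r// nnegrE ?expR_ge0// addr_ge0// invr_ge0.
rewrite mulrBl mul1r -expRD addNr expR0 e1.
have {}hx : 162 / 100 <= x by apply: le_trans hx; lra.
nra.
Qed.

(** Controls the term of [psiS] free of [y], uniformly in [N]. The factor [1 - expR (- 1)] is kept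
    because at least this proportion of a cube lies outside its stopping cubes, and that part pays
    for the term in the induction. *)
Lemma psi_gamma p N : 1 < p ->
  2^-1 `^ p + expR (- 1) * psi p N 1 <= (1 - expR (- 1)) * (expR 1 * (p * Gamma p)).
Proof.
move=> p1; have p0 : 0 < p by exact: lt_trans p1.
have -> : expR (- 1) * psi p N 1 = \sum_(k < N) expR (- k.+1%:R) *
     ((k.+1%:R + 2^-1) `^ p - (k%:R + 2^-1) `^ p).
  rewrite /psi mulr_sumr; apply: eq_bigr => k _.
  by rewrite mulrA -expRD -opprD -[k.+1]addn1 natrD [1 + _]addrC.
rewrite -lee_fin; apply: le_trans (sum_powRB_le_gamma N p1) _.
have G0 : 0 <= Gamma p.
  rewrite -lee_fin -EFin_Gamma//.
  by apply: integral_ge0 => t _; rewrite lee_fin gammaF_ge0.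
apply: (@le_trans _ _ ((expR 2^-1 * p)%:E * (Gamma p)%:E)%E).
  apply: lee_wpmul2l; first by rewrite lee_fin mulr_ge0 ?expR_ge0 ?(ltW p0).
  rewrite -EFin_Gamma//; apply: ge0_subset_integral => //.
  - exact: measurable_gammaF.
  - by move=> t _; rewrite lee_fin gammaF_ge0.
  - by move=> t /=; rewrite !in_itv/= => /andP[->].
rewrite -EFinM lee_fin -mulrA [leRHS]mulrA.
by rewrite ler_wpM2r ?mulr_ge0 ?(ltW p0)// exp_half.
Qed.

Lemma Gamma_gt0 p : 1 < p -> 0 < Gamma p.
Proof.
move=> p1; have p0 : 0 < p by exact: lt_trans p1.
have := psi_gamma 0 p1; rewrite /psi big_ord0 mulr0 addr0 => h.
have e1 : 0 < 1 - expR (- 1) :> R by rewrite subr_gt0 expR_lt1 oppr_lt0.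
have : 0 < (2^-1 : R) `^ p by rewrite powR_gt0.
move=> /lt_le_trans/(_ h).
by rewrite pmulr_rgt0// pmulr_rgt0 ?expR_gt0// pmulr_rgt0.
Qed.

End gamma.

(** * The induction on generations *)

Section one_step.
Context {R : realType} {n : nat}.
Local Notation Rn := (Rn R n).
Local Notation leb := (leb R n).
(** [aw a r] and [af a r] are the essential infima of [w] and [f] over the cube, known only through
    their defining properties, so that [f] can later be replaced by a translate. *)
Variables (n_gt0 : (0 < n)%N) (w f : Rn -> R) (aw af : Rn -> R -> R).
Variables (C M p T : R).
Hypotheses (w0 : forall x, 0 <= w x) (mw : measurable_fun setT w)
  (mf : measurable_fun setT f).
Hypotheses (C1 : 1 <= C) (M0 : 0 < M) (p1 : 1 < p) (T0 : 0 <= T).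

Hypotheses (aw_gt0 : forall a r, 0 < r -> 0 < aw a r)
  (aw_le : forall a r, 0 < r ->
     {ae leb, forall x, hcube a r x -> aw a r <= w x})
  (aw_ge : forall a r y, 0 < r ->
     {ae leb, forall x, hcube a r x -> y <= w x} -> y <= aw a r)
  (A1w : forall a r, 0 < r ->
     (wmeas w (hcube a r) <= (C * aw a r)%:E * leb (hcube a r))%E).

Hypotheses (af_le : forall a r, 0 < r ->
     {ae leb, forall x, hcube a r x -> af a r <= f x})
  (af_ge : forall a r y, 0 < r ->
     {ae leb, forall x, hcube a r x -> y <= f x} -> y <= af a r)
  (BLOf : forall a r, 0 < r ->
     (\int[leb]_(x in hcube a r) (Num.max (f x - af a r) 0)%:E
        <= M%:E * wmeas w (hcube a r))%E).

(** [B] times the infimum of [w] on a cube bounds the rise of the infimum of [f] from it to a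
    stopping cube: [expR 1 * C * M] comes from the stopping height and [2 ^+ n] from the volume of
    the parent. *)
Let B := 2 ^+ n * expR 1 * C * M.
Let c := expR 1 * (p * Gamma p).
Let eta : R := expR (- 1).
(** A bound on the share of [w] that the stopping cubes retain: outside them lies at least [1 - eta]
    times the infimum times the volume, which by the A_1 condition is at least [(1 - eta) / C] of
    the total. *)
Let theta := 1 - (1 - eta) / C.
Variable h : Rn -> R.
Hypotheses (h0 : forall x, 0 <= h x) (mh : measurable_fun setT h)
  (h_powR : forall x, h x <= (f x / B) `^ p * w x `^ (1 - p))
  (h_T : forall x, h x <= T * w x).

Let C0 : 0 < C. Proof. exact: lt_le_trans C1. Qed.
Let B0 : 0 < B. Proof. by rewrite !mulr_gt0// ?exprn_gt0// expR_gt0. Qed.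
Let p0 : 0 < p. Proof. exact: lt_trans p1. Qed.
Let eta_gt0 : 0 < eta. Proof. exact: expR_gt0. Qed.
Let eta_lt1 : eta < 1. Proof. by rewrite expR_lt1 oppr_lt0. Qed.
Let c0 : 0 <= c.
Proof. by rewrite mulr_ge0 ?expR_ge0// mulr_ge0// ltW// Gamma_gt0. Qed.
Let theta_ge0 : 0 <= theta.
Proof.
rewrite subr_ge0 ler_pdivrMr// mul1r; apply: le_trans C1.
by rewrite lerBlDr lerDl ltW.
Qed.
Let mEw (A : set Rn) : measurable_fun A (EFin \o w).
Proof. by apply/measurable_EFinP; exact: measurable_funTS. Qed.

Let mEh (A : set Rn) : measurable_fun A (EFin \o h).
Proof. by apply/measurable_EFinP; exact: measurable_funTS. Qed.

(** The cut-off [h <= T * w] supplies the case [N = 0]. The step decomposes the cube once, using the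
    pointwise bound on [h] off the stopping cubes and the induction hypothesis on each of them. *)
Lemma truncated_induction N a r : 0 < r -> 0 <= af a r ->
  (\int[leb]_(x in hcube a r) (h x)%:E <=
   (aw a r * psi p N (af a r / B / aw a r))%:E * leb (hcube a r) +
   (c + T * theta ^+ N)%:E * wmeas w (hcube a r))%E.
Proof.
elim: N a r => [|N IH] a r r0 af0; have mQ := measurable_hcube a r.
  rewrite /psi big_ord0 mulr0 mul0e add0e expr0 mulr1.
  apply: (@le_trans _ _ (T%:E * wmeas w (hcube a r))%E); last first.
    apply: lee_wpmul2r; last by rewrite lee_fin lerDr.
    by apply: integral_ge0 => x _; rewrite lee_fin.
  rewrite -ge0_integralZl//; last first.
  - by move=> x _; rewrite lee_fin.
  apply: ge0_le_integral.
  - exact: mQ.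
  - by move=> x _; rewrite lee_fin.
  - exact: mEh.
  - by apply: measurable_funeM; exact: mEw.
  - by move=> x _; rewrite -EFinM lee_fin h_T.
set A := aw a r; set al := af a r in af0 *; set Q := hcube a r in mQ *.
have A0 : 0 < A by exact: aw_gt0.
(* [M * C * A] bounds the mean of [f - al] over [Q]; the factor [expR 1] forces the stopping cubes
   to occupy at most [expR (- 1)] of [Q]. *)
pose lam := expR 1 * (M * C * A).
have lam0 : 0 < lam by rewrite !mulr_gt0// expR_gt0.
pose g x := Num.max (f x - al) 0 * \1_Q x.
have g0 x : 0 <= g x by rewrite mulr_ge0// le_max lexx orbT.
have mg : measurable_fun setT g.
  apply: measurable_funM; last exact: measurable_indic.
  apply: measurable_maxr; last exact: measurable_cst.
  by apply: measurable_funB; [exact: mf|exact: measurable_cst].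
have gQ : (\int[leb]_(x in Q) (g x)%:E <= (M * C * A)%:E * leb Q)%E.
  rewrite (eq_integral (fun x => (Num.max (f x - al) 0)%:E)); last first.
    by move=> x xQ; rewrite /g indicE xQ mulr1.
  apply: le_trans (BLOf a r0) _; rewrite -mulrA EFinM -muleA.
  by apply: lee_wpmul2l; [rewrite lee_fin ltW|exact: A1w].
have QE : leb Q = (r ^+ n)%:E by rewrite leb_hcube// ltW.
have ig : leb.-integrable setT (EFin \o g).
  apply/integrableP; split; first exact/measurable_EFinP.
  apply: (@le_lt_trans _ _ (\int[leb]_(x in Q) (g x)%:E)%E); last first.
    by apply: le_lt_trans gQ _; rewrite QE -EFinM ltry.
  rewrite [leRHS]integral_mkcond le_eqVlt; apply/orP; left; apply/eqP.
  apply: eq_integral => x _; rewrite /= patchE ger0_norm//.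
  by case: ifPn => // /negbTE xQ; rewrite /g indicE xQ mulr0.
have gle : (\int[leb]_(x in Q) (g x)%:E <= lam%:E * leb Q)%E.
  apply: le_trans gQ _; apply: lee_wpmul2r => //; rewrite lee_fin.
  rewrite ler_peMl// ?mulr_ge0 ?(ltW M0) ?(ltW C0) ?(ltW A0)//.
  by rewrite -expR0 ler_expR.
have [D [mD tD DQ HD aeD]] := calderon_zygmund r0 lam0 g0 ig gle.
set Om := \bigcup_i D i in DQ aeD *.
have mOm : measurable Om by exact: bigcupT_measurable.
pose E := Q `\` Om.
have mE : measurable E by exact: measurableD.
have QU : Q = E `|` Om.
  apply/seteqP; split => x; last by move=> [[]|/DQ].
  by move=> Qx; have [?|?] := pselect (Om x); [right|left].
have dE : [disjoint E & Om] by apply/disj_setPS => x [[_ nO]].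
have Qoo : (leb Q < +oo)%E by rewrite QE ltry.
pose W A' := wmeas w A'.
have WU : (W Q = W E + W Om)%E.
  rewrite /W /wmeas {1}QU ge0_integral_setU// => x _.
  by rewrite lee_fin.
have LU : (leb Q = leb E + leb Om)%E.
  by rewrite {1}QU; apply: measureU => //; apply/disj_set2P.
have hU : (\int[leb]_(x in Q) (h x)%:E = \int[leb]_(x in E) (h x)%:E +
    \int[leb]_(x in Om) (h x)%:E)%E.
  rewrite {1}QU ge0_integral_setU// => x _.
  by rewrite lee_fin.
have B2 : 2 ^+ n * lam = B * A by rewrite /lam /B; ring.
pose y := al / B / A.
have y0 : 0 <= y by rewrite divr_ge0 ?divr_ge0// ltW.
pose P := (y + 2^-1) `^ p.
have P0 : 0 <= P by exact: powR_ge0.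
(* the stopping height is at most half of the jump [B * A] because [0 < n] *)
have lam_half : lam <= B * A / 2.
  rewrite -B2 -[n in 2 ^+ n]prednK// exprS.
  have -> : 2 * 2 ^+ n.-1 * lam / 2 = 2 ^+ n.-1 * lam by field.
  by rewrite ler_peMl ?(ltW lam0)// exprn_ege1// ler1n.
(* Almost everywhere on [E], [f / B <= A * (y + 1/2)] and [w >= A]; as [1 - p < 0], the power of [w]
   is at most that of [A], and [h <= A * P] follows. *)
have hE : (\int[leb]_(x in E) (h x)%:E <= (A * P)%:E * leb E)%E.
  rewrite -integral_cst//; apply: ae_ge0_le_integral => //.
  - by move=> x _; rewrite lee_fin.
  - by move=> x _; rewrite lee_fin mulr_ge0// ltW.
  have ae1 := aw_le a r0; have ae2 := af_le a r0.
  move: ae1 ae2 aeD; apply: filterS3 => x ae1 ae2 aeD Ex.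
  have Qx : Q x by case: Ex.
  have {}ae1 := ae1 Qx; have {}ae2 := ae2 Qx; have {}aeD := aeD Ex.
  rewrite /cst lee_fin; apply: le_trans (h_powR x) _.
  have fx0 : 0 <= f x by exact: le_trans ae2.
  have wx0 : 0 < w x by exact: lt_le_trans ae1.
  have fxB : f x / B <= A * (y + 2^-1).
    rewrite ler_pdivrMr//.
    have -> : A * (y + 2^-1) * B = al + B * A / 2.
      by rewrite /y; field; rewrite !gt_eqF.
    rewrite -lerBlDl; apply: le_trans lam_half; apply: le_trans aeD.
    by rewrite /g indicE mem_set// mulr1 le_max lexx.
  apply: (@le_trans _ _ ((A * (y + 2^-1)) `^ p * A `^ (1 - p))).
    rewrite ler_pM ?powR_ge0//.
      by rewrite ge0_ler_powR ?nnegrE ?divr_ge0 ?(ltW B0) ?(ltW p0)// mulr_ge0 ?(ltW A0)// addr_ge0.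
    have -> : 1 - p = - (p - 1) by ring.
    rewrite !powRN lef_pV2 ?posrE ?powR_gt0//.
    by rewrite ge0_ler_powR ?nnegrE ?subr_ge0 ?(ltW p1)// ltW.
  rewrite powRM ?(ltW A0) ?addr_ge0// mulrAC -powRD ?(gt_eqF A0) ?implybT//.
  by rewrite addrCA subrr addr0 powRr1// ltW.
pose K1 := A * psi p N (y + 1); pose K2 := c + T * theta ^+ N.
have K10 : 0 <= K1 by rewrite mulr_ge0 ?(ltW A0)// psi_ge0// addr_ge0.
have K20 : 0 <= K2 by rewrite addr_ge0// mulr_ge0// exprn_ge0.
have mk (F : set Rn) : measurable_fun F (fun x => (K1 + K2 * w x)%:E).
  apply/measurable_EFinP; apply: measurable_funTS.
  apply: measurable_funD; first exact: measurable_cst.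
  by apply: measurable_funM; [exact: measurable_cst|exact: mw].
have kint (F : set Rn) : measurable F ->
    (\int[leb]_(x in F) (K1 + K2 * w x)%:E = K1%:E * leb F + K2%:E * W F)%E.
  move=> mF; rewrite -integral_cst; last exact: mF.
  have -> : (K2%:E * W F = \int[leb]_(x in F) (K2%:E * (w x)%:E))%E.
    rewrite ge0_integralZl; [by []|exact: mF|exact: mEw| |].
      by move=> x _; rewrite lee_fin.
    by rewrite lee_fin.
  rewrite -ge0_integralD; [by []|exact: mF| |exact: measurable_cst| |].
  - by move=> x _; rewrite /cst lee_fin.
  - by move=> x _; rewrite -EFinM lee_fin mulr_ge0.
  - by apply: measurable_funeM; exact: mEw.
(* On a stopping cube the induction hypothesis is bounded by the integral of [K1 + K2 * w], with the
   same [K1] and [K2] for all of them, so the bounds add up. *)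
have hOm : (\int[leb]_(x in Om) (h x)%:E <= K1%:E * leb Om + K2%:E * W Om)%E.
  rewrite -kint; last exact: mOm.
  apply: ge0_le_integral_bigcup; [exact: mD|exact: tD|exact: mEh|exact: mk| | |].
  - by move=> x _; rewrite lee_fin.
  - by move=> x _; rewrite lee_fin addr_ge0// mulr_ge0.
  move=> i; case: (HD i) => [->|[b [s [s0 Di lo hi]]]].
    by rewrite !integral_set0.
  have bQ : hcube b s `<=` Q by rewrite -Di => x Dx; apply: DQ; exists i.
  have LD : leb (hcube b s) = (s ^+ n)%:E by rewrite leb_hcube// ltW.
  rewrite Di in lo hi *; rewrite kint; last exact: measurable_hcube.
  have al_b : al <= af b s.
    by apply: af_ge => //; apply: filterS (af_le a r0) => x + /bQ; apply.
  have A_b : A <= aw b s.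
    by apply: aw_ge => //; apply: filterS (aw_le a r0) => x + /bQ; apply.
  (* The infimum of [f - al] over a stopping cube is at most its mean there, which is at most
     [2 ^+ n * lam = B * A]. *)
  have b_al : af b s <= al + B * A.
    rewrite -lerBlDl -B2 -(@ler_pM2r _ (s ^+ n)) ?exprn_gt0// -lee_fin.
    rewrite LD in hi; rewrite [leRHS]EFinM; apply: le_trans hi.
    rewrite EFinM -LD -integral_cst; last exact: measurable_hcube.
    have mb := measurable_hcube b s.
    apply: ae_ge0_le_integral; [exact: mb| |exact: measurable_cst| | |].
    - by move=> x _; rewrite /cst lee_fin subr_ge0.
    - by move=> x _; rewrite lee_fin.
    - by apply/measurable_EFinP; exact: measurable_funTS.
    apply: filterS (af_le b s0) => x h' bx; rewrite lee_fin /g indicE mem_set; last exact: bQ.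
    by rewrite mulr1 le_max lerD2r h'.
  apply: le_trans (IH b s s0 (le_trans af0 al_b)) _.
  apply: leeD => //; apply: lee_wpmul2r => //; rewrite lee_fin.
  have alb0 : 0 <= af b s / B by rewrite divr_ge0 ?(ltW B0)// (le_trans af0).
  (* The perspective inequality replaces the infimum of [w] on the small cube by the smaller [A];
     the height is then at most [y + 1]. *)
  apply: le_trans (psi_perspective _ p1 alb0 A0 A_b) _.
  rewrite /K1 ler_pM2l//; apply: psi_le => //; first by rewrite divr_ge0// ltW.
  rewrite ler_pdivrMr// ler_pdivrMr//.
  have -> : (y + 1) * A * B = al + B * A by rewrite /y; field; rewrite !gt_eqF.
  by [].
(* Chebyshev on the stopping cubes: the mean of [g] on each is at least [lam]. *)
have LOm : (lam%:E * leb Om <= (M * C * A)%:E * leb Q)%E.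
  apply: (@le_trans _ _ (\int[leb]_(x in Om) (g x)%:E)%E); last first.
    apply: le_trans gQ.
    apply: ge0_subset_integral; [exact: mOm|exact: mQ| | |exact: DQ].
    - by apply/measurable_EFinP; exact: measurable_funTS.
    - by move=> x _; rewrite lee_fin.
  rewrite -integral_cst; last exact: mOm.
  apply: ge0_le_integral_bigcup; [exact: mD|exact: tD|exact: measurable_cst| | | |].
  - by apply/measurable_EFinP; exact: measurable_funTS.
  - by move=> x _; rewrite /cst lee_fin (ltW lam0).
  - by move=> x _; rewrite lee_fin.
  move=> i; rewrite integral_cst; last exact: mD.
  case: (HD i) => [->|[b [s [_ _ + _]]]] //.
  by rewrite measure0 mule0 integral_set0.
have WE : (A%:E * leb E <= W E)%E.
  rewrite -integral_cst//; apply: ae_ge0_le_integral => //.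
  - by move=> x _; rewrite lee_fin ltW.
  - by move=> x _; rewrite lee_fin.
  apply: filterS (aw_le a r0) => x h' [Qx _]; rewrite lee_fin; exact: h'.
have WQ := A1w a r0.
have finW (F : set Rn) : measurable F -> F `<=` Q -> W F \is a fin_num.
  move=> mF FQ; rewrite ge0_fin_numE.
    apply: (@le_lt_trans _ _ (W Q)).
      by apply: ge0_subset_integral => // x _; rewrite lee_fin.
    by apply: le_lt_trans WQ _; rewrite QE -EFinM ltry.
  by apply: integral_ge0 => x _; rewrite lee_fin.
have finL (F : set Rn) : measurable F -> F `<=` Q -> leb F \is a fin_num.
  move=> mF FQ; rewrite ge0_fin_numE ?measure_ge0//.
  by apply: le_lt_trans Qoo; apply: le_measure; rewrite ?inE.
have EQ : E `<=` Q by move=> x [].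
(* All measures involved are finite, so the step reduces to an inequality between real numbers. *)
have realE (x : \bar R) : x \is a fin_num -> exists z, x = z%:E.
  by move=> xfin; exists (fine x); rewrite fineK.
have [mE' LE] := realE _ (finL _ mE EQ).
have [mO' LO] := realE _ (finL _ mOm DQ).
have [wE' WE'] := realE _ (finW _ mE EQ).
have [wO' WO'] := realE _ (finW _ mOm DQ).
have [wQ' WQ'] := realE _ (finW _ mQ (@subset_refl _ _)).
apply: (@le_trans _ _ ((A * P)%:E * leb E + (K1%:E * leb Om + K2%:E * W Om))%E).
  by rewrite hU; apply: leeD.
have {}WQ : (W Q <= (C * A)%:E * leb Q)%E by exact: WQ.
rewrite -[wmeas w Q]/(W Q).
clear hU hE hOm HD IH gQ gle aeD.
rewrite LE LO WE' WO' WQ' QE in LU WU WE LOm WQ *.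
move: (r ^+ n) LU LOm WQ => m LU LOm WQ.
have {LU}LU : m = mE' + mO' by case: LU.
have {WU}WU : wQ' = wE' + wO' by case: WU.
have {WE}WE : A * mE' <= wE' by rewrite -lee_fin EFinM.
have {LOm}LOm : lam * mO' <= M * C * A * m by rewrite -lee_fin !EFinM -!EFinM.
have {WQ}WQ : wQ' <= C * A * m by rewrite -lee_fin EFinM.
rewrite -!EFinM -!EFinD lee_fin.
rewrite -/y -/K2.
have LOm' : mO' <= eta * m.
  have MCA : 0 < M * C * A by rewrite !mulr_gt0.
  have : expR 1 * mO' <= m.
    rewrite -(ler_pM2l MCA); apply: le_trans LOm.
    by rewrite le_eqVlt; apply/orP; left; apply/eqP; rewrite /lam; ring.
  by rewrite -(ler_pM2l eta_gt0) mulrA -expRD addNr expR0 mul1r.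
have mO0 : 0 <= mO' by rewrite -lee_fin -LO measure_ge0.
have m0 : 0 <= m by rewrite LU addr_ge0// -lee_fin -LE measure_ge0.
have e1 : 0 <= 1 - eta by rewrite subr_ge0 ltW.
have X0 : 0 <= psi p N (y + 1) by rewrite psi_ge0// addr_ge0.
(* The terms in Lebesgue measure: [E] has measure at most [m] and [Om] at most [eta * m]; [psiS]
   recombines them and [psi_gamma] bounds the remainder. *)
have S1 : A * P * mE' + K1 * mO' <= A * m * (psi p N.+1 y + (1 - eta) * c).
  apply: (@le_trans _ _ (A * m * (P + eta * psi p N (y + 1)))); last first.
    rewrite ler_wpM2l ?mulr_ge0 ?(ltW A0)// psiS lerD2l; exact: psi_gamma.
  have -> : A * m * (P + eta * psi p N (y + 1)) = A * P * m + K1 * (eta * m).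
    by rewrite /K1; ring.
  apply: lerD; last exact: ler_wpM2l.
  by rewrite ler_wpM2l ?mulr_ge0 ?(ltW A0)// LU lerDl.
pose t := T * theta ^+ N.
have t0 : 0 <= t by rewrite mulr_ge0// exprn_ge0.
(* Since [w >= A] on [E], whose measure is at least [(1 - eta) * m], the weight of [Om] falls short
   of that of [Q] accordingly; times [c], this gap cancels the remainder in [S1]. *)
have S2 : K2 * wO' <= K2 * wQ' - K2 * (A * ((1 - eta) * m)).
  rewrite -mulrBr ler_wpM2l// WU lerBrDr addrC lerD2r.
  apply: le_trans WE; rewrite ler_pM2l// -(lerD2r mO') -LU.
  by rewrite mulrBl mul1r -lerBrDl opprB addrCA subrr addr0.
(* The same gap times [t] is converted by the A_1 condition into a share of [w(Q)], which shrinks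
   [t] to [t * theta]. *)
have S3 : t * ((1 - eta) / C) * wQ' <= t * (1 - eta) * (A * m).
  have -> : t * ((1 - eta) / C) * wQ' = t * (1 - eta) * (wQ' / C) by ring.
  apply: ler_wpM2l; first by rewrite mulr_ge0.
  rewrite ler_pdivrMr//.
  by have -> : A * m * C = C * A * m by ring.
have -> : T * theta ^+ N.+1 = t - t * ((1 - eta) / C).
  by rewrite exprSr mulrA -/t /theta; ring.
rewrite addrA; apply: le_trans (lerD S1 S2) _.
have -> : K2 = c + t by [].
move: S3; set u := t * ((1 - eta) / C) => S3.
have -> : A * m * (psi p N.+1 y + (1 - eta) * c) + ((c + t) * wQ' - (c + t) * (A * ((1 - eta) * m)))
   = A * psi p N.+1 y * m + (c + t) * wQ' - t * (1 - eta) * (A * m) by ring.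
have -> : A * psi p N.+1 y * m + (c + (t - u)) * wQ' =
   A * psi p N.+1 y * m + (c + t) * wQ' - u * wQ' by ring.
by rewrite lerD2l lerN2.
Qed.

End one_step.

(** * Removing the cut-off: the weighted power integral over one cube *)

Section weighted_power.
Context {R : realType} {n : nat}.
Local Notation Rn := (Rn R n).
Local Notation leb := (leb R n).
Variables (n_gt0 : (0 < n)%N) (w f : Rn -> R) (aw af : Rn -> R -> R).
Variables (C M p : R).
Hypotheses (w0 : forall x, 0 <= w x) (mw : measurable_fun setT w)
  (mf : measurable_fun setT f).
Hypotheses (C1 : 1 <= C) (M0 : 0 < M) (p1 : 1 < p).
Hypotheses (aw_gt0 : forall a r, 0 < r -> 0 < aw a r)
  (aw_le : forall a r, 0 < r ->
     {ae leb, forall x, hcube a r x -> aw a r <= w x})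
  (aw_ge : forall a r y, 0 < r ->
     {ae leb, forall x, hcube a r x -> y <= w x} -> y <= aw a r)
  (A1w : forall a r, 0 < r ->
     (wmeas w (hcube a r) <= (C * aw a r)%:E * leb (hcube a r))%E).
Hypotheses (af_le : forall a r, 0 < r ->
     {ae leb, forall x, hcube a r x -> af a r <= f x})
  (af_ge : forall a r y, 0 < r ->
     {ae leb, forall x, hcube a r x -> y <= f x} -> y <= af a r)
  (BLOf : forall a r, 0 < r ->
     (\int[leb]_(x in hcube a r) (Num.max (f x - af a r) 0)%:E
        <= M%:E * wmeas w (hcube a r))%E).

Let B := 2 ^+ n * expR 1 * C * M.
Let F al x := ((f x - al) / B) `^ p * w x `^ (1 - p).

Let mF al : measurable_fun setT (F al).
Proof.
apply: measurable_funM.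
  apply: (@measurableT_comp _ _ _ _ _ _ (@powR R ^~ p)).
    exact: measurable_powR.
  apply: measurable_funM; last exact: measurable_cst.
  by apply: measurable_funB; [exact: mf|exact: measurable_cst].
apply: (@measurableT_comp _ _ _ _ _ _ (@powR R ^~ (1 - p))); last exact: mw.
exact: measurable_powR.
Qed.

(** Applied to [f - af a r], whose infimum over the cube is 0, the induction loses its [psi] term;
    the error [k * theta ^+ N] tends to 0 as [N] grows. *)
Lemma integral_min_powR (k : nat) a r : 0 < r ->
  (\int[leb]_(x in hcube a r) (Num.min (F (af a r) x) (k%:R * w x))%:E <=
   (expR 1 * (p * Gamma p))%:E * wmeas w (hcube a r))%E.
Proof.
move=> r0; set al := af a r.
have C0 : 0 < C by exact: lt_le_trans C1.
have e1 : expR (- 1) < 1 :> R by rewrite expR_lt1 oppr_lt0.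
have e1' : 0 < expR (- 1) :> R by exact: expR_gt0.
have W0 : (0 <= wmeas w (hcube a r))%E.
  by apply: integral_ge0 => x _; rewrite lee_fin.
have Wfin : wmeas w (hcube a r) \is a fin_num.
  rewrite ge0_fin_numE//; apply: le_lt_trans (A1w a r0) _.
  by rewrite leb_hcube ?(ltW r0)// -EFinM ltry.
have mh : measurable_fun setT (fun x => Num.min (F al x) (k%:R * w x)).
  apply: measurable_minr; first exact: mF.
  by apply: measurable_funM; [exact: measurable_cst|exact: mw].
have h0 x : 0 <= Num.min (F al x) (k%:R * w x).
  by rewrite le_min !mulr_ge0 ?powR_ge0.
have mf' : measurable_fun setT (fun x => f x - al).
  by apply: measurable_funB; [exact: mf|exact: measurable_cst].
have af_le' b s : 0 < s -> {ae leb, forall x, hcube b s x -> af b s - al <= f x - al}.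
  by move=> s0; apply: filterS (af_le b s0) => x h /h; rewrite lerD2r.
have af_ge' b s y : 0 < s -> {ae leb, forall x, hcube b s x -> y <= f x - al} ->
    y <= af b s - al.
  move=> s0 h; rewrite lerBrDr; apply: af_ge => //.
  by apply: filterS h => x h /h; rewrite lerBrDr.
have BLOf' b s : 0 < s ->
     (\int[leb]_(x in hcube b s) (Num.max (f x - al - (af b s - al)) 0)%:E
        <= M%:E * wmeas w (hcube b s))%E.
  move=> s0; apply: le_trans (BLOf b s0).
  rewrite le_eqVlt; apply/orP; left; apply/eqP; apply: eq_integral => x _.
  by congr (Num.max _ _)%:E; ring.
have hF x : Num.min (F al x) (k%:R * w x) <= F al x by rewrite ge_min lexx.
have hT x : Num.min (F al x) (k%:R * w x) <= k%:R * w x.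
  by rewrite ge_min lexx orbT.
have main N := @truncated_induction _ _ n_gt0 w _ aw (fun b s => af b s - al)
  C M p k%:R w0 mw mf' C1 M0 p1 (ler0n _ _) aw_gt0 aw_le aw_ge A1w af_le' af_ge'
  BLOf' _ h0 mh hF hT N a r r0.
set theta := 1 - (1 - expR (- 1)) / C in main.
set c := expR 1 * (p * Gamma p) in main *.
have {}main N : (\int[leb]_(x in hcube a r) (Num.min (F al x) (k%:R * w x))%:E <=
    (c + k%:R * theta ^+ N)%:E * wmeas w (hcube a r))%E.
  have := main N; rewrite -/al subrr => /(_ (lexx _)).
  by rewrite !mul0r psi0 mulr0 mul0e add0e.
have th : `|theta| < 1.
  rewrite /theta ger0_norm; last first.
    rewrite subr_ge0 ler_pdivrMr// mul1r; apply: le_trans C1.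
    by rewrite lerBlDr lerDl ltW.
  by rewrite ltrBlDr ltrDl divr_gt0// subr_gt0.
apply/lee_addgt0Pr => e e0; move: main Wfin W0.
case: (wmeas w (hcube a r)) => // W main _; rewrite lee_fin => W0.
pose d := e / (k%:R * W + 1).
have kW : 0 < k%:R * W + 1 by rewrite ltr_wpDl// mulr_ge0.
have d0 : 0 < d by rewrite divr_gt0.
have /cvgrPdist_lt/(_ _ d0)[N _ /(_ N (leqnn _))] := cvg_expr th.
rewrite /= sub0r normrN => /ltW/(le_trans (ler_norm _)) hN.
apply: le_trans (main N) _; rewrite -!EFinM -EFinD lee_fin mulrDl lerD2l.
have -> : k%:R * theta ^+ N * W = k%:R * W * theta ^+ N by ring.
apply: (@le_trans _ _ (k%:R * W * d)).
  by apply: ler_wpM2l => //; rewrite mulr_ge0.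
have -> : k%:R * W * d = e * (k%:R * W / (k%:R * W + 1)) by rewrite /d; ring.
by rewrite ler_piMr ?(ltW e0)// ler_pdivrMr// mul1r lerDl.
Qed.

(** Monotone convergence as the cut-off level [k] increases. *)
Lemma integral_powR a r : 0 < r ->
  (\int[leb]_(x in hcube a r) (F (af a r) x)%:E <=
   (expR 1 * (p * Gamma p))%:E * wmeas w (hcube a r))%E.
Proof.
move=> r0; set al := af a r; have mQ := measurable_hcube a r.
pose g (k : nat) x := (Num.min (F al x) (k%:R * w x))%:E.
have limg x : limn (g ^~ x) = (F al x)%:E.
  apply: lim_near_cst => //.
  have [k Hk] : exists k : nat, F al x <= k%:R * w x.
    have [wx|wx] := ltP 0 (w x).
      have F0 : 0 <= F al x / w x by rewrite !mulr_ge0 ?powR_ge0// invr_ge0 ltW.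
      exists (Num.bound (F al x / w x)); rewrite -ler_pdivrMr// ltW//.
      exact: archi_boundP.
    (* Where [w] vanishes, so does [F], because 0 raised to the nonzero exponent [1 - p] is 0 by
       convention; the cut-off is then exact. *)
    have wx0 : w x = 0 by apply/eqP; rewrite eq_le wx w0.
    exists 0%N; rewrite mul0r /F wx0 powR0 ?mulr0//.
    by rewrite subr_eq0 lt_eqF.
  exists k => // m /= km; rewrite /g; congr (_%:E); apply/min_idPl.
  by apply: le_trans Hk _; rewrite ler_wpM2r// ler_nat.
have mg k : measurable_fun (hcube a r) (g k).
  apply/measurable_EFinP; apply: measurable_funTS.
  apply: measurable_minr; first exact: mF.
  by apply: measurable_funM; [exact: measurable_cst|exact: mw].
have g0 k x : hcube a r x -> (0 <= g k x)%E.
  by move=> _; rewrite lee_fin le_min !mulr_ge0 ?powR_ge0.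
have ndg x : hcube a r x -> {homo g ^~ x : k m / (k <= m)%N >-> (k <= m)%E}.
  move=> _ k m km; rewrite lee_fin le_min !ge_min lexx/=.
  by rewrite ler_wpM2r ?ler_nat// orbT.
have -> : (\int[leb]_(x in hcube a r) (F al x)%:E =
    \int[leb]_(x in hcube a r) limn (g ^~ x))%E.
  by apply: eq_integral => x _; rewrite limg.
rewrite (monotone_convergence _ mQ mg g0 ndg).
apply: lime_le.
  apply: ereal_nondecreasing_is_cvgn => k m km.
  apply: ge0_le_integral; [exact: mQ|exact: g0|exact: mg|exact: mg|].
  by move=> x Qx; exact: ndg.
by apply: nearW => k; exact: integral_min_powR.
Qed.

End weighted_power.

(** * Essential infima over cubes *)

Section cube_facts.
Context {R : realType} {n : nat}.
Local Notation Rn := (Rn R n).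
Local Notation leb := (leb R n).
Implicit Types (f w : Rn -> R) (a : Rn) (r : R).

Lemma leb_hcube_gt0 a r : 0 < r -> (0 < leb (hcube a r))%E.
Proof. by move=> r0; rewrite leb_hcube ?(ltW r0)// lte_fin exprn_gt0. Qed.

Lemma bigcup_cube : \bigcup_k cube ([tuple - k%:R | i < n] : Rn) (2 * k%:R) = setT.
Proof.
apply/seteqP; split => // x _.
pose s := \sum_(i < n) `|pcoord x i|.
have s0 : 0 <= s by apply: sumr_ge0.
exists (Num.bound s) => // i.
have : `|pcoord x i| <= (Num.bound s)%:R.
  apply: (@le_trans _ _ s); last by rewrite ltW// archi_boundP.
  by rewrite /s (bigD1 i)//= lerDl sumr_ge0.
have -> : pcoord ([tuple - (Num.bound s)%:R | i < n] : Rn) i = - (Num.bound s)%:R.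
  by rewrite /pcoord tnth_mktuple.
by rewrite ler_norml => /andP[-> h] /=; move: h; lra.
Qed.

Lemma loc_integrable_measurable f : loc_integrable f -> measurable_fun setT f.
Proof.
move=> lf; rewrite -bigcup_cube; apply/measurable_fun_bigcup.
  by move=> k; exact: measurable_cube.
move=> k; apply/measurable_EFinP.
by have /integrableP[] := lf ([tuple - k%:R | i < n] : Rn) (2 * k%:R).
Qed.

(** The closed cube minus the half-open one is null, and the complement of the closed cube is null
    for the restricted measure. *)
Lemma ae_hcube a r (P : Rn -> Prop) : 0 < r ->
  {ae mrestr leb (measurable_cube a r), forall x, P x} <->
  {ae leb, forall x, hcube a r x -> P x}.
Proof.
move=> r0; have mc := measurable_cube a r; have mh := measurable_hcube a r.
split => -[N [mN N0 NP]].
  exists (N `&` cube a r); split => //; first exact: measurableI.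
  move=> x /= /not_implyP[hx nP]; split; first exact: NP.
  exact: hcube_sub.
exists (N `|` ~` cube a r `|` (cube a r `\` hcube a r)); split.
- by apply: measurableU; [apply: measurableU => //; exact: measurableC|exact: measurableD].
- rewrite /mrestr; apply/eqP; rewrite -measure_le0.
  apply: (@le_trans _ _ (leb (N `|` (cube a r `\` hcube a r)))).
    apply: le_measure; rewrite ?inE.
    + apply: measurableI => //.
      by apply: measurableU; [apply: measurableU => //; exact: measurableC|exact: measurableD].
    + by apply: measurableU => //; exact: measurableD.
    by move=> x [[[?|?]|?] ?]; [left|by []|right].
  apply: le_trans (measureU2 _ _ _) _ => //; first exact: measurableD.
  by rewrite [X in (X + _)%E]N0 add0e /= leb_cubeD// ltW.
- move=> x /= nP; have [cx|ncx] := pselect (cube a r x); last by left; right.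
  have [hx|nhx] := pselect (hcube a r x); last by right.
  by left; left; apply: NP => /= /(_ hx).
Qed.

Lemma ess_inf_cube_ge a r f (y : \bar R) : 0 < r ->
  (y <= ess_inf_cube a r f)%E <->
  {ae leb, forall x, hcube a r x -> (y <= (f x)%:E)%E}.
Proof.
move=> r0; have E := @ae_hcube a r (fun x => (y <= (f x)%:E)%E) r0.
split => h; last exact/ess_infP/(proj2 E).
by apply: (proj1 E); exact/ess_infP.
Qed.

Lemma ess_inf_cube_le a r f : 0 < r ->
  {ae leb, forall x, hcube a r x -> (ess_inf_cube a r f <= (f x)%:E)%E}.
Proof. by move=> r0; apply/ess_inf_cube_ge. Qed.

Lemma ae_hcube_false a r : 0 < r ->
  ~ {ae leb, forall x, hcube a r x -> False}.
Proof.
move=> r0 [N [mN N0 NP]]; have := leb_hcube_gt0 a r0; rewrite lt_neqAle.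
suff -> : leb (hcube a r) = 0%E by rewrite eqxx.
by apply: subset_measure0 N0 => //; [exact: measurable_hcube|move=> x hx; apply: NP => /= /(_ hx)].
Qed.

Lemma ess_inf_cube_lty a r f : 0 < r -> (ess_inf_cube a r f < +oo)%E.
Proof.
move=> r0; rewrite ltey; apply/eqP => foo.
apply: (ae_hcube_false (a := a) r0).
by apply: filterS (ess_inf_cube_le a f r0) => x /[apply]; rewrite foo.
Qed.

Lemma integral_hcube a r (F : Rn -> \bar R) : 0 < r ->
  (forall x, (0 <= F x)%E) -> measurable_fun setT F ->
  (\int[leb]_(x in cube a r) F x = \int[leb]_(x in hcube a r) F x)%E.
Proof.
move=> r0 F0 mF.
have mc := measurable_cube a r; have mh := measurable_hcube a r.
have mD : measurable (cube a r `\` hcube a r) by exact: measurableD.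
rewrite (ge0_negligible_integral (mu := leb) mD mc (measurable_funTS mF)
  (fun x _ => F0 x) (leb_cubeD a (ltW r0))).
congr (integral _ _ _); rewrite setDD setIidr//.
exact: hcube_sub.
Qed.

End cube_facts.

(** * Weights satisfying the A_1 condition *)

Section A1_weight.
Context {R : realType} {n : nat}.
Local Notation Rn := (Rn R n).
Local Notation leb := (leb R n).
Variables (w : Rn -> R) (C : R).
Hypotheses (ww : weight w) (Cw : A1_bound w C).
Implicit Types (a : Rn) (r : R).

Let w0 x : 0 <= w x. Proof. by case: ww. Qed.

Lemma measurable_weight : measurable_fun setT w.
Proof. by case: ww => _ _; exact: loc_integrable_measurable. Qed.

Lemma wmeas_cube a r : 0 < r -> wmeas w (cube a r) = wmeas w (hcube a r).
Proof.
move=> r0; apply: integral_hcube; [exact: r0|by move=> x; rewrite lee_fin|].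
by apply/measurable_EFinP; exact: measurable_weight.
Qed.

Lemma wmeas_hcube_fin a r : 0 < r -> wmeas w (hcube a r) \is a fin_num.
Proof.
move=> r0; rewrite -wmeas_cube//; case: ww => _ _ /(_ a r) iw.
by have := integrable_fin_num (measurable_cube a r) iw.
Qed.

Lemma wmeas_hcube_gt0 a r : 0 < r -> (0 < wmeas w (hcube a r))%E.
Proof.
move=> r0; rewrite lt0e; apply/andP; split; last first.
  by apply: integral_ge0 => x _; rewrite lee_fin.
apply/negP => /eqP W0; apply: (ae_hcube_false (a := a) r0).
have mQ := measurable_hcube a r.
have /ae_eq_integral_abs : (\int[leb]_(x in hcube a r) `|(w x)%:E| = 0)%E.
  by rewrite -[RHS]W0; apply: eq_integral => x _; rewrite gee0_abs ?lee_fin.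
move=> /(_ mQ).
have mw : measurable_fun (hcube a r) (EFin \o w).
  by apply/measurable_EFinP; apply: measurable_funTS; exact: measurable_weight.
move=> /(_ mw) wae; case: ww => _ wpos _.
move: wae wpos; apply: filterS2 => x + wx Qx => /(_ Qx) /= -[].
by move/eqP; rewrite gt_eqF.
Qed.

(** [fine] turns an infinite essential infimum into 0, so the value is meaningful only once
    finiteness has been shown. *)
Definition cube_inf (f : Rn -> R) a r := fine (ess_inf_cube a r f).

Lemma A1_mul a r : 0 < r ->
  (wmeas w (hcube a r) <= (C%:E * ess_inf_cube a r w) * leb (hcube a r))%E.
Proof.
move=> r0; have := (Cw.2 a r r0); rewrite wmeas_cube//.
have rn : 0 < r ^+ n by rewrite exprn_gt0.
rewrite leb_cube ?(ltW r0)// leb_hcube ?(ltW r0)// inver gt_eqF//.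
have := wmeas_hcube_fin a r0; case: (wmeas w _) => // W _.
have C0 := Cw.1.
have := ess_inf_cube_lty a w r0; case: (ess_inf_cube a r w) => // [e _|_].
  by rewrite -!EFinM !lee_fin ler_pdivrMr.
by rewrite -EFinM gt0_muleNy ?lte_fin// leeNy_eq.
Qed.

Lemma cube_inf_weight a r : 0 < r ->
  ess_inf_cube a r w = (cube_inf w a r)%:E.
Proof.
move=> r0; rewrite /cube_inf fineK//.
have := A1_mul a r0; have := wmeas_hcube_gt0 a r0.
have := ess_inf_cube_lty a w r0; case: (ess_inf_cube a r w) => // _ + h.
rewrite gt0_muleNy ?lte_fin ?Cw.1// gt0_mulNye ?leb_hcube_gt0// in h.
by move=> /lt_le_trans/(_ h); rewrite ltNge leNye.
Qed.

Lemma cube_inf_weight_gt0 a r : 0 < r -> 0 < cube_inf w a r.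
Proof.
move=> r0; have := A1_mul a r0; have W0 := wmeas_hcube_gt0 a r0.
move=> /(lt_le_trans W0); rewrite cube_inf_weight// leb_hcube ?(ltW r0)//.
by rewrite -!EFinM lte_fin pmulr_lgt0 ?exprn_gt0// pmulr_rgt0// Cw.1.
Qed.

Lemma cube_inf_weight_le a r : 0 < r ->
  {ae leb, forall x, hcube a r x -> cube_inf w a r <= w x}.
Proof.
move=> r0; apply: filterS (ess_inf_cube_le a w r0) => x /[apply].
by rewrite cube_inf_weight// lee_fin.
Qed.

Lemma cube_inf_weight_ge a r y : 0 < r ->
  {ae leb, forall x, hcube a r x -> y <= w x} -> y <= cube_inf w a r.
Proof.
move=> r0 h; rewrite -lee_fin -cube_inf_weight//; apply/ess_inf_cube_ge => //.
Qed.

Lemma A1_ge1 : 1 <= C.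
Proof.
pose a : Rn := [tuple 0 | i < n]; have r0 : (0 : R) < 1 by [].
have A0 := cube_inf_weight_gt0 a r0.
have mQ := measurable_hcube a 1.
have h : ((cube_inf w a 1)%:E * leb (hcube a 1) <= wmeas w (hcube a 1))%E.
  rewrite -integral_cst//; apply: ae_ge0_le_integral; [exact: mQ| |exact: measurable_cst| | |].
  - by move=> x _; rewrite /cst lee_fin ltW.
  - by move=> x _; rewrite lee_fin.
  - by apply/measurable_EFinP; apply: measurable_funTS; exact: measurable_weight.
  - by apply: filterS (cube_inf_weight_le a r0) => x h /h; rewrite lee_fin.
have := le_trans h (A1_mul a r0); rewrite cube_inf_weight// leb_hcube ?ler01//.
by rewrite expr1n !mule1 -EFinM lee_fin -[leLHS]mul1r ler_pM2r.
Qed.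

End A1_weight.

(** * BLO norms *)

Section BLO.
Context {R : realType} {n : nat}.
Local Notation Rn := (Rn R n).
Local Notation leb := (leb R n).
Variables (w : Rn -> R).
Hypotheses (ww : weight w).
Implicit Types (a : Rn) (r p : R) (f : Rn -> R).

Let w0 x : 0 <= w x. Proof. by case: ww. Qed.

(** When the infimum is finite, the positive part changes the integrand only on a null subset of the
    cube; it keeps the base of the power nonnegative at every point. *)
Definition BLO_dev p f a r x : R :=
  Num.max (f x - cube_inf f a r) 0 `^ p * w x `^ (1 - p).

Lemma measurable_powR_comp (q : R) (g : Rn -> R) :
  measurable_fun setT g -> measurable_fun setT (fun x => g x `^ q).
Proof.
move=> mg; apply: (@measurableT_comp _ _ _ _ _ _ (@powR R ^~ q)); last exact: mg.
exact: measurable_powR.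
Qed.

Lemma measurable_BLO_dev p f a r : measurable_fun setT f ->
  measurable_fun setT (BLO_dev p f a r).
Proof.
move=> mf; apply: measurable_funM; apply: measurable_powR_comp.
  apply: measurable_maxr; last exact: measurable_cst.
  by apply: measurable_funB; [exact: mf|exact: measurable_cst].
exact: measurable_weight.
Qed.

Lemma BLO_dev_ge0 p f a r x : 0 <= BLO_dev p f a r x.
Proof. by rewrite mulr_ge0 ?powR_ge0. Qed.

Lemma cube_inf_le f a r : 0 < r -> ess_inf_cube a r f \is a fin_num ->
  {ae leb, forall x, hcube a r x -> cube_inf f a r <= f x}.
Proof.
move=> r0 ff; apply: filterS (ess_inf_cube_le a f r0) => x /[apply].
by rewrite -lee_fin /cube_inf fineK.
Qed.

Lemma integral_BLO_dev p f a r : 0 < r -> measurable_fun setT f ->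
  ess_inf_cube a r f \is a fin_num ->
  (\int[leb]_(x in cube a r)
     (((f x)%:E - ess_inf_cube a r f) `^ p * (w x `^ (1 - p))%:E) =
   \int[leb]_(x in hcube a r) (BLO_dev p f a r x)%:E)%E.
Proof.
move=> r0 mf ff; have mQ := measurable_hcube a r.
pose F x := (f x - cube_inf f a r) `^ p * w x `^ (1 - p).
have mF : measurable_fun setT F.
  apply: measurable_funM; apply: measurable_powR_comp.
    by apply: measurable_funB; [exact: mf|exact: measurable_cst].
  exact: measurable_weight.
have -> : (\int[leb]_(x in cube a r)
     (((f x)%:E - ess_inf_cube a r f) `^ p * (w x `^ (1 - p))%:E) =
     \int[leb]_(x in cube a r) (F x)%:E)%E.
  by apply: eq_integral => x _; rewrite -(fineK ff).
rewrite integral_hcube; [|exact: r0| |]; last 2 first.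
- by move=> x; rewrite lee_fin mulr_ge0 ?powR_ge0.
- by apply/measurable_EFinP; exact: mF.
apply: ge0_ae_eq_integral; [exact: mQ| | | | |].
- by apply/measurable_EFinP; apply: measurable_funTS; exact: mF.
- by apply/measurable_EFinP; apply: measurable_funTS; exact: measurable_BLO_dev.
- by move=> x _; rewrite lee_fin mulr_ge0 ?powR_ge0.
- by move=> x _; rewrite lee_fin BLO_dev_ge0.
apply: filterS (cube_inf_le r0 ff) => x h /h h'.
by rewrite /F /BLO_dev; congr (_ `^ _ * _)%:E; apply/esym/max_idPl; rewrite subr_ge0.
Qed.

Definition BLO_term p f a r : \bar R :=
  (((wmeas w (cube a r))^-1 * \int[leb]_(x in cube a r)
     (((f x)%:E - ess_inf_cube a r f) `^ p * (w x `^ (1 - p))%:E)) `^ p^-1)%E.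

Lemma BLO_term_le p f a r : 0 < r -> (BLO_term p f a r <= BLO_norm w p f)%E.
Proof. by move=> r0; apply: ereal_sup_ubound; exists (a, r). Qed.

Lemma BLO_norm_leP p f (M : \bar R) :
  (forall a r, 0 < r -> (BLO_term p f a r <= M)%E) -> (BLO_norm w p f <= M)%E.
Proof. by move=> h; apply: ge_ereal_sup => _ [[a r] /= r0 <-]; exact: h. Qed.

Lemma BLO_norm_ge0 p f : (0 <= BLO_norm w p f)%E.
Proof.
apply: le_trans (BLO_term_le p f ([tuple 0 | i < n] : Rn) ltr01).
exact: poweR_ge0.
Qed.

Lemma wmeas_wpow_gt0 (q : R) a r : 0 < r ->
  (0 < wmeas (wpow w q) (hcube a r))%E.
Proof.
move=> r0; have mQ := measurable_hcube a r.
rewrite lt0e; apply/andP; split; last first.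
  by apply: integral_ge0 => x _; rewrite lee_fin powR_ge0.
apply/negP => /eqP W0; apply: (ae_hcube_false (a := a) r0).
have /ae_eq_integral_abs : (\int[leb]_(x in hcube a r) `|(w x `^ q)%:E| = 0)%E.
  by rewrite -[RHS]W0; apply: eq_integral => x _; rewrite gee0_abs ?lee_fin ?powR_ge0.
move=> /(_ mQ).
have mw : measurable_fun (hcube a r) (fun x => (w x `^ q)%:E).
  apply/measurable_EFinP; apply: measurable_funTS.
  by apply: measurable_powR_comp; exact: measurable_weight.
move=> /(_ mw) wae; case: ww => _ wpos _.
move: wae wpos; apply: filterS2 => x + wx Qx => /(_ Qx) /= -[].
by move/eqP; rewrite gt_eqF// powR_gt0.
Qed.

Lemma BLO_term_infty p f a r : 0 < p -> 0 < r -> ess_inf_cube a r f = -oo%E ->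
  BLO_term p f a r = +oo%E.
Proof.
move=> p0 r0 foo; rewrite /BLO_term foo wmeas_cube//.
have mc := measurable_cube a r.
have -> : (\int[leb]_(x in cube a r)
    (((f x)%:E - -oo) `^ p * (w x `^ (1 - p))%:E) = +oo)%E.
  have -> : (\int[leb]_(x in cube a r)
    (((f x)%:E - -oo) `^ p * (w x `^ (1 - p))%:E) = +oo *
     \int[leb]_(x in cube a r) (w x `^ (1 - p))%:E)%E.
    rewrite -ge0_integralZl; [|exact: mc| | |]; last 3 first.
    - apply/measurable_EFinP; apply: measurable_funTS.
      by apply: measurable_powR_comp; exact: measurable_weight.
    - by move=> x _; rewrite lee_fin powR_ge0.
    - by [].
    by apply: eq_integral => x _; rewrite /= gt_eqF.
  rewrite gt0_mulye// integral_hcube; [|exact: r0| |]; last 2 first.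
  - by move=> x; rewrite lee_fin powR_ge0.
  - apply/measurable_EFinP.
    by apply: measurable_powR_comp; exact: measurable_weight.
  exact: wmeas_wpow_gt0.
have := wmeas_hcube_fin ww a r0; have := wmeas_hcube_gt0 ww a r0.
case: (wmeas w _) => // W; rewrite lte_fin => W0 _.
by rewrite inver gt_eqF// gt0_muley ?lte_fin ?invr_gt0// poweRyr// invr_eq0 gt_eqF.
Qed.

Lemma ess_inf_cube_fin p f a r (M : R) : 0 < p -> 0 < r ->
  (BLO_norm w p f <= M%:E)%E -> ess_inf_cube a r f \is a fin_num.
Proof.
move=> p0 r0 fM; have := ess_inf_cube_lty a f r0.
have := @BLO_term_infty p f a r p0 r0.
case: (ess_inf_cube a r f) => // /(_ erefl) too _.
by have := le_trans (BLO_term_le p f a r0) fM; rewrite too leye_eq.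
Qed.

Lemma BLO_termE p f a r : 0 < r -> measurable_fun setT f ->
  ess_inf_cube a r f \is a fin_num -> BLO_term p f a r =
  (((fine (wmeas w (hcube a r)))^-1%:E *
     \int[leb]_(x in hcube a r) (BLO_dev p f a r x)%:E) `^ p^-1)%E.
Proof.
move=> r0 mf ff; rewrite /BLO_term integral_BLO_dev// wmeas_cube//.
have := wmeas_hcube_fin ww a r0; have := wmeas_hcube_gt0 ww a r0.
case: (wmeas w _) => // W; rewrite lte_fin => W0 _.
by rewrite inver gt_eqF.
Qed.

Lemma BLO_norm1_bound f a r (M : R) : 0 < r -> measurable_fun setT f ->
  (BLO_norm w 1 f <= M%:E)%E ->
  (\int[leb]_(x in hcube a r) (Num.max (f x - cube_inf f a r) 0)%:E
    <= M%:E * wmeas w (hcube a r))%E.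
Proof.
move=> r0 mf fM; have ff := ess_inf_cube_fin a ltr01 r0 fM.
have := le_trans (BLO_term_le 1 f a r0) fM; rewrite BLO_termE//.
have -> : (\int[leb]_(x in hcube a r) (BLO_dev 1 f a r x)%:E =
   \int[leb]_(x in hcube a r) (Num.max (f x - cube_inf f a r) 0)%:E)%E.
  apply: eq_integral => x _; congr (_%:E).
  by rewrite /BLO_dev subrr powRr0 mulr1 powRr1// le_max lexx orbT.
have I0 : (0 <= \int[leb]_(x in hcube a r) (Num.max (f x - cube_inf f a r) 0)%:E)%E.
  by apply: integral_ge0 => x _; rewrite lee_fin le_max lexx orbT.
have := wmeas_hcube_fin ww a r0; have := wmeas_hcube_gt0 ww a r0.
case: (wmeas w _) => // W; rewrite lte_fin => W0 _ /=.
rewrite invr1 poweRe1; last by rewrite mule_ge0// lee_fin invr_ge0 ltW.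
by rewrite muleC lee_pdivrMr// muleC.
Qed.

(** The constant of the theorem at [C = delta = 1] without the A_1 factor: the root of [C1] has been
    moved inside the other root, and [2 ^+ n * expR 1] is the inverse of [C2]. *)
Definition BLO_kappa p : R := 2 ^+ n * expR 1 * (expR 1 * (p * Gamma p)) `^ p^-1.

Lemma BLO_norm_bound (C p M : R) f : (0 < n)%N -> A1_bound w C -> 1 < p -> 0 < M ->
  measurable_fun setT f -> (BLO_norm w 1 f <= M%:E)%E ->
  (BLO_norm w p f <= (C * M * BLO_kappa p)%:E)%E.
Proof.
move=> n0 Cw p1 M0 mf fM; apply: BLO_norm_leP => a r r0.
have ff := ess_inf_cube_fin a ltr01 r0 fM.
have C1 : 1 <= C by exact: A1_ge1 Cw.
have C0 : 0 < C by exact: lt_le_trans C1.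
have p0 : 0 < p by exact: lt_trans p1.
pose B := 2 ^+ n * expR 1 * C * M.
have B0 : 0 < B by rewrite !mulr_gt0 ?exprn_gt0 ?expR_gt0.
pose c := expR 1 * (p * Gamma p).
have c0 : 0 <= c by rewrite mulr_ge0 ?expR_ge0// mulr_ge0 ?(ltW p0)// ltW// Gamma_gt0.
have af_le b s : 0 < s -> {ae leb, forall x, hcube b s x -> cube_inf f b s <= f x}.
  by move=> s0; apply: cube_inf_le => //; exact: ess_inf_cube_fin ltr01 s0 fM.
have af_ge b s y : 0 < s -> {ae leb, forall x, hcube b s x -> y <= f x} ->
    y <= cube_inf f b s.
  move=> s0 h; rewrite -lee_fin /cube_inf fineK; last exact: ess_inf_cube_fin ltr01 s0 fM.
  by apply/ess_inf_cube_ge.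
have A1' b s : 0 < s ->
    (wmeas w (hcube b s) <= (C * cube_inf w b s)%:E * leb (hcube b s))%E.
  by move=> s0; rewrite EFinM -(cube_inf_weight ww Cw)//; exact: A1_mul.
have main := @integral_powR _ _ n0 w f (cube_inf w) (cube_inf f) C M p w0
  (measurable_weight ww) mf C1 M0 p1 (cube_inf_weight_gt0 ww Cw)
  (cube_inf_weight_le ww Cw) (cube_inf_weight_ge ww Cw) A1' af_le af_ge
  (fun b s s0 => @BLO_norm1_bound f b s M s0 mf fM) a r r0.
have mQ := measurable_hcube a r.
have dev : (\int[leb]_(x in hcube a r) (BLO_dev p f a r x)%:E <=
    (B `^ p * c)%:E * wmeas w (hcube a r))%E.
  rewrite EFinM -muleA; apply: le_trans (lee_wpmul2l _ main); last first.
    by rewrite lee_fin powR_ge0.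
  rewrite -ge0_integralZl; [|exact: mQ| | |]; last 3 first.
  - apply/measurable_EFinP; apply: measurable_funTS.
    apply: measurable_funM; apply: measurable_powR_comp; last exact: measurable_weight.
    apply: measurable_funM; last exact: measurable_cst.
    by apply: measurable_funB; [exact: mf|exact: measurable_cst].
  - by move=> x _; rewrite lee_fin mulr_ge0 ?powR_ge0.
  - by rewrite lee_fin powR_ge0.
  apply: ae_ge0_le_integral; [exact: mQ| | | | |].
  - by move=> x _; rewrite lee_fin BLO_dev_ge0.
  - by apply/measurable_EFinP; apply: measurable_funTS; exact: measurable_BLO_dev.
  - by move=> x _; rewrite -EFinM lee_fin !mulr_ge0 ?powR_ge0.
  - apply: measurable_funeM; apply/measurable_EFinP; apply: measurable_funTS.
    apply: measurable_funM; apply: measurable_powR_comp; last exact: measurable_weight.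
    apply: measurable_funM; last exact: measurable_cst.
    by apply: measurable_funB; [exact: mf|exact: measurable_cst].
  apply: filterS (af_le a r r0) => x h /h h'; rewrite -EFinM lee_fin /BLO_dev.
  have d0 : 0 <= f x - cube_inf f a r by rewrite subr_ge0.
  have -> : Num.max (f x - cube_inf f a r) 0 = f x - cube_inf f a r by apply/max_idPl.
  rewrite mulrA -powRM ?(ltW B0)//; last by rewrite divr_ge0// ltW.
  by rewrite -/B [B * _]mulrC divfK ?gt_eqF.
rewrite BLO_termE//.
have Bc0 : 0 <= B `^ p * c by rewrite mulr_ge0 ?powR_ge0.
have -> : C * M * BLO_kappa p = (B `^ p * c) `^ p^-1.
  rewrite powRM ?powR_ge0// -powRrM mulfV ?gt_eqF// powRr1 ?(ltW B0)//.
  by rewrite /BLO_kappa -/c /B; ring.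
rewrite -poweR_EFin; apply: gt0_ler_poweR.
- by rewrite invr_ge0 ltW.
- rewrite in_itv/= leey andbT mule_ge0//.
    by rewrite lee_fin invr_ge0 fine_ge0// ltW// wmeas_hcube_gt0.
  by apply: integral_ge0 => x _; rewrite lee_fin BLO_dev_ge0.
- by rewrite in_itv/= leey andbT lee_fin.
move: dev; have := wmeas_hcube_fin ww a r0; have := wmeas_hcube_gt0 ww a r0.
case: (wmeas w _) => // W; rewrite lte_fin => W0 _ /= dev.
by rewrite muleC lee_pdivrMr.
Qed.

End BLO.

(** * Comparison of the norms *)

Section comparison.
Context {R : realType} {n : nat}.
Local Notation Rn := (Rn R n).
Local Notation leb := (leb R n).
Variables (w : Rn -> R) (p : R).
Hypotheses (ww : weight w) (p1 : 1 < p).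
Implicit Types (a : Rn) (r : R) (f : Rn -> R).

Let w0 x : 0 <= w x. Proof. by case: ww. Qed.
Let p0 : 0 < p. Proof. exact: lt_trans p1. Qed.

(** Young's inequality for the product of [x / (t * v)] and 1 with exponents [p] and [p'],
    multiplied by [t * v]. *)
Lemma young_dev (t x v : R) : 0 < t -> 0 < v -> 0 <= x ->
  x <= t `^ (1 - p) / p * (x `^ p * v `^ (1 - p)) + t * (1 - p^-1) * v.
Proof.
move=> t0 v0 x0; have tv : 0 < t * v by rewrite mulr_gt0.
pose q := p / (p - 1).
have q0 : 0 < q by rewrite divr_gt0// subr_gt0.
have pq : p^-1 + q^-1 = 1.
  by rewrite /q invf_div -{1}(div1r p) -mulrDl addrC subrK mulfV// gt_eqF.
have xtv : 0 <= x / (t * v) by rewrite divr_ge0// ltW.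
have := conjugate_powR xtv ler01 p0 q0 pq; rewrite mulr1 powR1 mul1r.
have -> : q^-1 = 1 - p^-1 by rewrite -pq addrAC subrr add0r.
rewrite -(ler_pM2r tv) divfK ?gt_eqF// => /le_trans; apply.
have xp : x `^ p * (t `^ (1 - p) * v `^ (1 - p)) = (x / (t * v)) `^ p * (t * v).
  rewrite -powRM ?(ltW t0) ?(ltW v0)// -{1}(divfK (lt0r_neq0 tv) x).
  rewrite (powRM _ xtv (ltW tv)) -mulrA -powRD ?(gt_eqF tv) ?implybT//.
  by rewrite addrCA subrr addr0 powRr1// ltW.
have -> : t `^ (1 - p) / p * (x `^ p * v `^ (1 - p)) =
  (x / (t * v)) `^ p * (t * v) / p by rewrite -xp; ring.
by rewrite le_eqVlt; apply/orP; left; apply/eqP; ring.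
Qed.

(** Hoelder's inequality obtained by integrating [young_dev] at [v = w x]: as [y <= t^p], the two
    terms contribute at most [t / p] and [t * (1 - 1/p)] times the weight of the cube. *)
Lemma integral_dev1_le f a r (t y : R) : 0 < r -> measurable_fun setT f ->
  0 < t -> 0 <= y -> y <= t `^ p ->
  (\int[leb]_(x in hcube a r) (BLO_dev w p f a r x)%:E =
    y%:E * wmeas w (hcube a r))%E ->
  (\int[leb]_(x in hcube a r) (BLO_dev w 1 f a r x)%:E
    <= t%:E * wmeas w (hcube a r))%E.
Proof.
move=> r0 mf t0 y0 yt Ip; have mQ := measurable_hcube a r.
have k1 : 0 <= t `^ (1 - p) / p by rewrite divr_ge0 ?powR_ge0// ltW.
have k2 : 0 <= t * (1 - p^-1).
  by rewrite mulr_ge0 ?(ltW t0)// subr_ge0 invf_le1// ltW.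
have mdev q (A : set Rn) : measurable_fun A (fun x => (BLO_dev w q f a r x)%:E).
  by apply/measurable_EFinP; apply: measurable_funTS; exact: measurable_BLO_dev.
have mwt (A : set Rn) : measurable_fun A (fun x => (w x)%:E).
  by apply/measurable_EFinP; apply: measurable_funTS; exact: measurable_weight.
apply: (@le_trans _ _ (\int[leb]_(x in hcube a r)
  ((t `^ (1 - p) / p)%:E * (BLO_dev w p f a r x)%:E +
   (t * (1 - p^-1))%:E * (w x)%:E))%E).
  apply: ae_ge0_le_integral; [exact: mQ| | | | |].
  - by move=> x _; rewrite lee_fin mulr_ge0 ?powR_ge0.
  - exact: mdev.
  - move=> x _; rewrite -!EFinM -EFinD lee_fin addr_ge0// mulr_ge0//.
    by rewrite mulr_ge0 ?powR_ge0.
  - by apply: emeasurable_funD; apply: measurable_funeM; [exact: mdev|exact: mwt].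
  case: (ww) => _ wpos _; apply: filterS wpos => x wx _.
  rewrite -!EFinM -EFinD lee_fin /BLO_dev subrr powRr0 mulr1.
  have x0 : 0 <= Num.max (f x - cube_inf f a r) 0 by rewrite le_max lexx orbT.
  by rewrite powRr1//; exact: young_dev.
rewrite ge0_integralD; [|exact: mQ| | | |]; last 4 first.
- by move=> x _; rewrite -EFinM lee_fin mulr_ge0// mulr_ge0 ?powR_ge0.
- by apply: measurable_funeM; exact: mdev.
- by move=> x _; rewrite -EFinM lee_fin mulr_ge0.
- by apply: measurable_funeM; exact: mwt.
rewrite ge0_integralZl; [|exact: mQ|exact: mdev| |]; last 2 first.
- by move=> x _; rewrite lee_fin mulr_ge0 ?powR_ge0.
- by rewrite lee_fin.
rewrite ge0_integralZl; [|exact: mQ|exact: mwt| |]; last 2 first.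
- by move=> x _; rewrite lee_fin.
- by rewrite lee_fin.
rewrite Ip -/(wmeas w (hcube a r)).
have := wmeas_hcube_fin ww a r0; have := wmeas_hcube_gt0 ww a r0.
case: (wmeas w _) => // W; rewrite lte_fin => W0 _.
rewrite -!EFinM -EFinD lee_fin mulrA -mulrDl ler_pM2r//.
apply: (@le_trans _ _ (t `^ (1 - p) / p * t `^ p + t * (1 - p^-1))).
  by rewrite lerD2r ler_wpM2l.
rewrite mulrAC -powRD ?(gt_eqF t0) ?implybT// subrK powRr1 ?(ltW t0)//.
by rewrite le_eqVlt; apply/orP; left; apply/eqP; ring.
Qed.

Lemma BLO_norm1_le f : measurable_fun setT f ->
  (BLO_norm w 1 f <= BLO_norm w p f)%E.
Proof.
move=> mf; apply: BLO_norm_leP => a r r0; apply: le_trans (BLO_term_le w p f a r0).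
have [ff|] := boolP (ess_inf_cube a r f \is a fin_num); last first.
  rewrite fin_numE negb_and !negbK => /orP[/eqP foo|/eqP foo].
    by rewrite (BLO_term_infty ww p0 r0 foo) leey.
  by have := ess_inf_cube_lty a f r0; rewrite foo ltxx.
rewrite !BLO_termE// invr1.
set I1 := (\int[leb]_(x in _) (BLO_dev w 1 f a r x)%:E)%E.
have I10 : (0 <= I1)%E.
  by apply: integral_ge0 => x _; rewrite lee_fin mulr_ge0 ?powR_ge0.
have Ip0 : (0 <= \int[leb]_(x in hcube a r) (BLO_dev w p f a r x)%:E)%E.
  by apply: integral_ge0 => x _; rewrite lee_fin mulr_ge0 ?powR_ge0.
have Wfin := wmeas_hcube_fin ww a r0; have W0 := wmeas_hcube_gt0 ww a r0.
have := @integral_dev1_le f a r _ _ r0 mf; rewrite -/I1.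
rewrite -{1 2}(fineK Wfin); move: W0; rewrite -{1}(fineK Wfin) lte_fin.
move: (fine _) => W W0; move: Ip0.
case: (\int[leb]_(x in hcube a r) (BLO_dev w p f a r x)%:E)%E => [I| |] //.
  rewrite lee_fin => I0 h; rewrite poweRe1; last first.
    by rewrite mule_ge0// lee_fin invr_ge0 ltW.
  rewrite muleC lee_pdivrMr// -?EFinM ?poweR_EFin; set y := W^-1 * I.
  have y0 : 0 <= y by rewrite mulr_ge0// invr_ge0 ltW.
  (* The parameter is [t = y^(1/p) + e], positive even when [y = 0]; [e] is arbitrary. *)
  rewrite EFinM -lee_pdivrMr//; apply/lee_addgt0Pr => e e0; rewrite lee_pdivrMr//.
  rewrite -EFinD; apply: (h _ y) => //.
  - by rewrite ltr_wpDl ?powR_ge0.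
  - rewrite -[leLHS]powRr1// -(mulVf (lt0r_neq0 p0)) powRrM.
    by rewrite ge0_ler_powR ?nnegrE ?powR_ge0 ?(ltW p0) ?addr_ge0 ?powR_ge0 ?(ltW e0)// lerDl ltW.
  - by rewrite -EFinM /y mulrAC mulVf ?gt_eqF// mul1r.
move=> _ _; rewrite [X in (_ <= X `^ _)%E]gt0_muley ?lte_fin ?invr_gt0//.
by rewrite poweRyr ?invr_eq0 ?gt_eqF// leey.
Qed.

(** Taking [E] to be a whole half-open cube gives [1 <= C']. If [delta > 1], adding up the estimate
    over the cells of level [k] gains a factor that decays geometrically in [k], against the
    positivity of the [nu]-measure of the cube. *)
Lemma Ainfty_consts (C delta : R) : (0 < n)%N -> A1_bound w C ->
  forall C' : R, 0 < C' ->
  Ainfty_bound (wpow w (1 - p)) C' delta -> 1 <= C' /\ delta <= 1.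
Proof.
move=> n0 Cw C' C'0 Ai.
pose a : Rn := [tuple 0 | i < n]; have r0 : (0 : R) < 1 by [].
set nu := wpow w (1 - p) in Ai *.
have nu0 x : 0 <= nu x by exact: powR_ge0.
have mnu : measurable_fun setT nu.
  by apply: measurable_powR_comp; exact: measurable_weight.
have mQ := measurable_hcube a (1 : R).
have nuQ0 : (0 < wmeas nu (hcube a 1))%E by exact: wmeas_wpow_gt0.
have LQ : leb (hcube a 1) = 1%E by rewrite leb_hcube// expr1n.
(* As [1 - p < 0], [nu] is bounded on the cube by the same power of the positive infimum of [w]. *)
have nuQoo : (wmeas nu (hcube a 1) < +oo)%E.
  pose A := cube_inf w a 1.
  have A0 : 0 < A := cube_inf_weight_gt0 ww Cw a r0.
  apply: (@le_lt_trans _ _ ((A `^ (1 - p))%:E * leb (hcube a 1))%E); last first.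
    by rewrite LQ mule1 ltry.
  rewrite -integral_cst; last exact: mQ.
  apply: ae_ge0_le_integral; [exact: mQ| | | |exact: measurable_cst|].
  - by move=> x _; rewrite lee_fin.
  - by apply/measurable_EFinP; exact: measurable_funTS.
  - by move=> x _; rewrite /cst lee_fin powR_ge0.
  apply: filterS (cube_inf_weight_le ww Cw a r0) => x h /h Aw.
  have -> : 1 - p = - (p - 1) by ring.
  rewrite /cst lee_fin /nu /wpow -opprB !powRN lef_pV2 ?posrE ?powR_gt0//.
    by rewrite ge0_ler_powR ?nnegrE ?subr_ge0 ?(ltW p1)// ltW.
  exact: lt_le_trans Aw.
have nuQ : wmeas nu (cube a 1) = wmeas nu (hcube a 1).
  apply: integral_hcube; [exact: r0|by move=> x; rewrite lee_fin|].
  by apply/measurable_EFinP.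
have LQ' : leb (cube a 1) = 1%E by rewrite leb_cube// expr1n.
have Ai' (E : set Rn) : measurable E -> E `<=` cube a 1 ->
    (wmeas nu E <= (C' * fine (leb E) `^ delta * fine (wmeas nu (hcube a 1)))%:E)%E.
  move=> mE EQ; have := Ai a 1 E r0 mE EQ; rewrite nuQ LQ' inve1 mule1.
  have : leb E \is a fin_num.
    rewrite ge0_fin_numE ?measure_ge0//; apply: (@le_lt_trans _ _ (leb (cube a 1))).
      by apply: le_measure; rewrite ?inE//; exact: measurable_cube.
    by rewrite LQ' ltry.
  case: (leb E) => // l _; move: nuQ0 nuQoo; case: (wmeas nu (hcube a 1)) => // N.
  by rewrite lte_fin => N0 _; rewrite inver gt_eqF// lee_pdivrMr.
have nuQfin : wmeas nu (hcube a 1) \is a fin_num by rewrite ge0_fin_numE// ltW.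
set N := fine (wmeas nu (hcube a 1)) in Ai'.
have NE : wmeas nu (hcube a 1) = N%:E by rewrite fineK.
have N0 : 0 < N by rewrite -lte_fin -NE.
split.
  have := Ai' _ mQ (@hcube_sub _ _ _ _); rewrite NE LQ lee_fin /= powR1 mulr1.
  by rewrite ler_pMl.
rewrite leNgt; apply/negP => d1.
pose g x := nu x * \1_(hcube a 1) x.
have g0 x : 0 <= g x by rewrite mulr_ge0.
have mg : measurable_fun setT g.
  by apply: measurable_funM; [exact: mnu|exact: measurable_indic].
have gnu E : E `<=` hcube a 1 ->
    (\int[leb]_(x in E) (g x)%:E = wmeas nu E)%E.
  move=> EQ; apply: eq_integral => x /set_mem /EQ Qx.
  by rewrite /g indicE mem_set// mulr1.
have ig : leb.-integrable setT (EFin \o g).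
  apply/integrableP; split; first exact/measurable_EFinP.
  suff -> : (\int[leb]_x `|(EFin \o g) x|)%E = wmeas nu (hcube a 1).
    by rewrite NE ltry.
  rewrite [RHS]integral_mkcond; apply: eq_integral => x _.
  rewrite /= patchE ger0_norm//.
  by case: ifPn => [|/negbTE] xQ; rewrite /g indicE xQ ?mulr1 ?mulr0.
(* Each cell of level [k] has measure [q <= 2^-k], hence [nu]-mean at most [C' * q^(delta - 1) * N];
   summing over the cells gives [N] on the left. *)
have key k : 1 <= C' * (2^-1 `^ (delta - 1)) ^+ k.
  pose q : R := (1 / 2 ^+ k) ^+ n.
  have q0 : 0 < q by rewrite exprn_gt0// divr_gt0// exprn_gt0.
  have lam0 : 0 <= C' * q `^ (delta - 1) * N.
    by rewrite !mulr_ge0 ?powR_ge0// ltW.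
  have := @le_integral_level _ _ a 1 _ g r0 lam0 g0 ig k setT.
  rewrite preimage_setT setTI LQ mule1 (gnu _ (@subset_refl _ _)) NE lee_fin => h.
  have {h} : N <= C' * q `^ (delta - 1) * N.
    apply: h => z zQ; rewrite gnu//.
    have zc : cell a 1 k z `<=` cube a 1 by apply: subset_trans zQ (@hcube_sub _ _ _ _).
    apply: le_trans (Ai' _ (measurable_cell a k z r0) zc) _.
    rewrite leb_cell// -/q -EFinM lee_fin /=.
    have -> : delta = (delta - 1) + 1 by ring.
    rewrite powRD ?(gt_eqF q0) ?implybT// powRr1 ?(ltW q0)// addrK.
    by rewrite le_eqVlt; apply/orP; left; apply/eqP; ring.
  rewrite ler_pMl// => h; apply: le_trans h _; apply: ler_wpM2l; first exact: ltW.
  rewrite -powR_mulrn ?powR_ge0// -powRrM mulrC powRrM powR_mulrn ?invr_ge0//.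
  have s0 : 0 <= 2^-1 ^+ k :> R by rewrite exprn_ge0// invr_ge0.
  have s1 : 2^-1 ^+ k <= 1 :> R by rewrite exprn_ile1 ?invr_ge0// invf_le1// ler1n.
  apply: ge0_ler_powR; rewrite ?nnegrE ?subr_ge0 ?(ltW d1) ?(ltW q0)//.
  by rewrite /q div1r -exprVn -[n]prednK// exprS ler_piMr// exprn_ile1.
set rho := 2^-1 `^ (delta - 1) in key.
have rho0 : 0 <= rho by exact: powR_ge0.
have rho1 : `|rho| < 1.
  rewrite ger0_norm// /rho.
  apply: (@lt_le_trans _ _ (1 `^ (delta - 1))); last by rewrite powR1.
  by rewrite gt0_ltr_powR ?nnegrE ?subr_gt0// invf_lt1// ltr1n.
have C'V : 0 < C'^-1 by rewrite invr_gt0.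
have /cvgrPdist_lt/(_ _ C'V)[k _ /(_ k (leqnn _))] := cvg_expr rho1.
rewrite /= sub0r normrN ger0_norm ?exprn_ge0// => hk.
have := key k; rewrite leNgt => /negP; apply.
by rewrite -(mulfV (lt0r_neq0 C'0)) ltr_pM2l.
Qed.

End comparison.

(** * The A_1 constant and the constant of the theorem *)

Section sharp_constant.
Context {R : realType} {n : nat}.
Local Notation Rn := (Rn R n).
Variables (w : Rn -> R) (p : R).
Hypotheses (n_gt0 : (0 < n)%N) (A1w : A1 w) (p1 : 1 < p).

Let p0 : 0 < p. Proof. exact: lt_trans p1. Qed.

Lemma A1_const_ge1 : 1 <= A1_const w.
Proof.
case: A1w => ww [C Cw]; apply: lb_le_inf; first by exists C.
by move=> C' C'w; exact: A1_ge1 C'w.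
Qed.

Lemma BLO_kappa_gt0 : 0 < BLO_kappa (R := R) (n := n) p.
Proof.
rewrite !mulr_gt0 ?exprn_gt0 ?expR_gt0// powR_gt0// !mulr_gt0 ?expR_gt0//.
exact: Gamma_gt0.
Qed.

(** [BLO_norm_bound] holds for every admissible [C] and every real [M > 0] above the norm; the
    infimum over [C] gives [A1_const w], and [M] decreases to the norm. *)
Lemma BLO_norm_le (f : Rn -> R) : measurable_fun setT f ->
  (BLO_norm w p f <=
   (A1_const w * BLO_kappa (R := R) (n := n) p)%:E * BLO_norm w 1 f)%E.
Proof.
move=> mf; have A0 : 0 < A1_const w by exact: lt_le_trans A1_const_ge1.
have k0 := BLO_kappa_gt0; set k := BLO_kappa p in k0 *.
case: A1w => ww [C0 C0w].
have main C M : A1_bound w C -> 0 < M -> (BLO_norm w 1 f <= M%:E)%E ->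
    (BLO_norm w p f <= (C * M * k)%:E)%E.
  by move=> Cw M0 fM; exact: BLO_norm_bound.
clearbody k.
have := BLO_norm_ge0 w p f; have := BLO_norm_ge0 w 1 f.
case: (BLO_norm w 1 f) main => [m main|_ _ _|//]; last first.
  by rewrite gt0_muley ?leey// lte_fin mulr_gt0.
rewrite lee_fin => m0; case: (BLO_norm w p f) main => [b main|main|//] _; last first.
  (* Finiteness first: any admissible constant and [M = m + 1] will do. *)
  have m1 : 0 < m + 1 by rewrite ltr_wpDl.
  have := main C0 (m + 1) C0w m1; rewrite lee_fin lerDl => /(_ ler01).
  by rewrite leye_eq.
rewrite -EFinM lee_fin mulrC -ler_pdivrMr ?mulr_gt0//.
(* [M = m + e] rather than [m], since [M] has to be positive and [m] may be 0. *)
apply/ler_addgt0Pr => e e0; have me : 0 < m + e by rewrite ltr_wpDl.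
have mek : 0 < (m + e) * k by rewrite mulr_gt0.
suff : b / ((m + e) * k) <= A1_const w.
  rewrite !ler_pdivrMr ?mulr_gt0//.
  by have -> : (m + e) * (A1_const w * k) = A1_const w * ((m + e) * k) by ring.
apply: lb_le_inf; first by exists C0.
move=> C Cw; rewrite ler_pdivrMr ?mulr_gt0// mulrA -lee_fin; apply: main => //.
by rewrite lee_fin lerDl ltW.
Qed.

(** Apart from monotonicity in [C], the claim is [expR (1/p) <= expR (delta/p) / delta], that is
    [delta <= expR ((delta - 1)/p)]; this follows from [1 + x <= expR x] since [1 < p] and
    [delta <= 1]. *)
Lemma BLO_const_ge (C delta : R) : 1 <= C -> 0 < delta -> delta <= 1 ->
  A1_const w * BLO_kappa (R := R) (n := n) p <= BLO_const w p C delta.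
Proof.
move=> C1 d0 d1; rewrite /BLO_const /BLO_kappa -[leRHS]mulrA.
have A0 : 0 < A1_const w by exact: lt_le_trans A1_const_ge1.
rewrite ler_pM2l//; set u := 2 ^+ n * expR 1.
have u0 : 0 < u by rewrite mulr_gt0 ?exprn_gt0 ?expR_gt0.
have G0 := Gamma_gt0 p1; have pG : 0 < p * Gamma p by rewrite mulr_gt0.
have e0 : (0 : R) < expR 1 by exact: expR_gt0.
have -> : (C * p * Gamma p) `^ p^-1 * (expR 1 `^ (delta / p) / (u^-1 * delta)) =
    u * ((C * p * Gamma p) `^ p^-1 * (expR 1 `^ (delta / p) / delta)).
  by field; rewrite !gt_eqF.
rewrite ler_pM2l// powRM ?(ltW e0) ?(ltW pG)// [leLHS]mulrC.
apply: ler_pM; rewrite ?powR_ge0//.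
  apply: ge0_ler_powR; rewrite ?nnegrE ?invr_ge0 ?(ltW p0) ?(ltW pG)//.
    by rewrite -mulrA mulr_ge0 ?(ltW pG)// (le_trans _ C1).
  by rewrite -mulrA ler_peMl// ltW.
rewrite ler_pdivlMr// -!expRM !mul1r.
have h : delta <= expR ((delta - 1) / p).
  apply: le_trans (expR_ge1Dx _).
  rewrite -lerBlDl ler_pdivlMr// -subr_ge0.
  have -> : delta - 1 - (delta - 1) * p = (1 - delta) * (p - 1) by ring.
  by rewrite mulr_ge0 ?subr_ge0// ltW.
have -> : delta / p = p^-1 + (delta - 1) / p by field; rewrite gt_eqF.
by rewrite expRD ler_pM2l ?expR_gt0.
Qed.

(** Makes [Ap_eps] nonnegative, hence the exponent [eps / (1 + eps)] at most 1. A single cube bounds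
    the supremum from below. *)
Lemma Ap_const_ge0 (nu : Rn -> R) : (forall x, 0 <= nu x) ->
  (0 <= Ap_const p nu)%E.
Proof.
move=> nu0; pose c : Rn * R := ([tuple 0 | i < n], 1).
apply: le_ereal_sup_tmp; eexists; first by exists c => //=; exact: ltr01.
have cube_ge0 (v : Rn -> R) : (forall x, 0 <= v x) ->
    (0 <= wmeas v (cube c.1 c.2) / leb R n (cube c.1 c.2))%E.
  move=> v0; rewrite mule_ge0 ?inve_ge0//.
  by apply: integral_ge0 => x _; rewrite lee_fin.
by rewrite mule_ge0 ?poweR_ge0// cube_ge0.
Qed.

End sharp_constant.

Theorem theorem7p5 (R : realType) (n : nat) (n_gt0 : (0 < n)%N)
    (w : Rn R n -> R) (A1w : A1 w) (p : R) (p_gt1 : 1 < p) :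
  (exists2 K : R, 0 < K & forall f : Rn R n -> R, loc_integrable f ->
     (BLO_norm w 1 f <= K%:E * BLO_norm w p f)%E /\
     (BLO_norm w p f <= K%:E * BLO_norm w 1 f)%E) /\
  (forall f : Rn R n -> R, loc_integrable f ->
     (BLO_norm w 1 f <= BLO_norm w p f)%E) /\
  (forall C delta : R, 0 < C -> 0 < delta ->
     Ainfty_bound (wpow w (1 - p)) C delta \/
     (C = 2 /\ delta = Ap_eps p (wpow w (1 - p)) /
                       (1 + Ap_eps p (wpow w (1 - p)))) ->
     forall f : Rn R n -> R, loc_integrable f ->
     (BLO_norm w p f <= (BLO_const w p C delta)%:E * BLO_norm w 1 f)%E).
Proof.
have ww : weight w by case: A1w.
have hoelder f : loc_integrable f -> (BLO_norm w 1 f <= BLO_norm w p f)%E.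
  move=> lf; apply: BLO_norm1_le; [exact: ww|exact: p_gt1|].
  exact: loc_integrable_measurable.
have k0 : 0 < A1_const w * BLO_kappa (R := R) (n := n) p.
  apply: mulr_gt0; last exact: BLO_kappa_gt0.
  by apply: lt_le_trans (A1_const_ge1 A1w).
split; [|split; [exact: hoelder|]].
  exists (1 + A1_const w * BLO_kappa (R := R) (n := n) p).
    by rewrite ltr_wpDr// ltW.
  move=> f lf; split.
    apply: le_trans (hoelder f lf) _; rewrite -{1}[BLO_norm w p f]mul1e.
    by apply: lee_wpmul2r; [exact: BLO_norm_ge0|rewrite lee_fin lerDl ltW].
  apply: le_trans (BLO_norm_le n_gt0 A1w p_gt1 (loc_integrable_measurable lf)) _.
  by apply: lee_wpmul2r; [exact: BLO_norm_ge0|rewrite lee_fin lerDr].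
move=> C delta C0 d0 hC f lf.
apply: le_trans (BLO_norm_le n_gt0 A1w p_gt1 (loc_integrable_measurable lf)) _.
apply: lee_wpmul2r; first exact: BLO_norm_ge0.
rewrite lee_fin.
(* Both alternatives are reduced to the range in which [BLO_const] dominates its value at
   [C = delta = 1]. *)
have [C1 d1] : 1 <= C /\ delta <= 1.
  case: hC => [Ai|[-> ->]].
    by case: A1w => _ [C' C'w]; exact: Ainfty_consts C'w _ C0 Ai.
  split; first by rewrite ler1n.
  have e0 : 0 <= Ap_eps p (wpow w (1 - p)).
    rewrite invr_ge0 mulr_ge0 ?powR_ge0// fine_ge0// Ap_const_ge0//.
    by move=> x; exact: powR_ge0.
  by rewrite ler_pdivrMr ?ltr_wpDr// mul1r lerDr.
exact: BLO_const_ge.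
Qed.
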